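(* Let $n\in\omega$ and let $P\leq\mathrm{Sym}(\mathbb{N})$ be a locally finite, $(n+1)$-free Polish permutation group. Let $\mathcal{L}$ be a countable language and $\sigma$ an $\mathcal{L}_{\omega_1,\omega}$-sentence such that for every $\mathcal{N}\in\mathrm{Str}(\sigma,\mathbb{N})$ and all $b_0,\dots,b_n\in\mathrm{dom}(\mathcal{N})$ there is some $i\leq n$ with $b_i\in\mathrm{acl}_{\mathcal{N}}(\{b_j:j\neq i\})$. Then $E(P)$ is generically ergodic with respect to $(\mathrm{Str}^{\mathrm{inj}}_{\mathbb{R}}(\sigma,\mathbb{N}),\simeq_{\mathrm{iso}})$, i.e., $E(P)$ is generically $\simeq_{\mathrm{iso}}$-ergodic where $\simeq_{\mathrm{iso}}$ is the orbit equivalence relation on $\mathrm{Str}^{\mathrm{inj}}_{\mathbb{R}}(\sigma,\mathbb{N})$.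
   Context: For $P\leq\mathrm{Sym}(\mathbb{N})$ closed and $A\subseteq\mathbb{N}$: $P_A$ is the pointwise stabilizer, $[A]_P:=\{a: P_A\cdot a\text{ finite}\}$; $P$ is locally finite if $[A]_P$ is finite for all finite $A$; $P$ is $k$-free if for every finite $A$ there are $g_0,\dots,g_{k-1}\in P$ with $[g_i\cdot A]_P\cap[\bigcup_{j\neq i}g_j\cdot A]_P=\emptyset$ for every $i<k$. $E(P)$ is the orbit equivalence relation of the Bernoulli shift $P\curvearrowright\mathbb{R}^{\mathbb{N}}$, $(gx)(a)=x(g^{-1}(a))$. $\mathrm{Str}(\sigma,\mathbb{N})$ is the Polish space of $\mathcal{L}$-structures with domain $\mathbb{N}$ satisfying $\sigma$, with the logic action of $\mathrm{Sym}(\mathbb{N})$ ($g\mathcal{N}\models R(\bar n)\iff\mathcal{N}\models R(g^{-1}\bar n)$, $g\mathcal{N}\models f(\bar n)=m\iff \mathcal{N}\models f(g^{-1}\bar n)=g^{-1}(m)$). $\mathrm{Str}^{\mathrm{inj}}_{\mathbb{R}}(\sigma,\mathbb{N}):=\mathrm{Inj}(\mathbb{N},\mathbb{R})\times\mathrm{Str}(\sigma,\mathbb{N})$ with the action $g\cdot(x,\mathcal{N})=(gx,g\mathcal{N})$, where $\mathrm{Inj}(\mathbb{N},\mathbb{R})$ is the set of injective sequences and $(gx)(a)=x(g^{-1}(a))$; $\simeq_{\mathrm{iso}}$ is its orbit equivalence relation. $\mathrm{acl}_{\mathcal{N}}(B)$ is the set of elements $b$ satisfying some $\mathcal{L}$-formula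 with parameters from $B$ having finitely many realizations in $\mathcal{N}$. $E$ on $X$ is generically $F$-ergodic ($F$ on $Y$) if every Baire-measurable $f:X\to Y$ with $x\,E\,x'\Rightarrow f(x)\,F\,f(x')$ maps a comeager set into one $F$-class. *)

(* Defs.v *)
From Stdlib Require Import Reals List.
From mathcomp Require Import ssreflect ssrbool ssrnat fintype.
Open Scope R_scope.

Definition finN (S : nat -> Prop) : Prop :=
  exists l : list nat, forall a, S a -> In a l.

Definition is_perm (g : nat -> nat) : Prop :=
  exists h : nat -> nat, (forall a, h (g a) = a) /\ (forall a, g (h a) = a).

(* P <= Sym(N) is a closed subgroup (= Polish permutation group), where
   Sym(N) carries the pointwise-convergence topology. *)
Definition closed_perm_group (P : (nat -> nat) -> Prop) : Prop :=
  (forall g, P g -> is_perm g) /\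
  P (fun a => a) /\
  (forall g h, P g -> P h -> P (fun a => g (h a))) /\
  (forall g, P g -> exists h, P h /\ (forall a, h (g a) = a) /\ (forall a, g (h a) = a)) /\
  (forall g, is_perm g ->
     (forall m : nat, exists h, P h /\ forall a, (a < m)%N -> h a = g a) -> P g).

Definition stab (P : (nat -> nat) -> Prop) (A : nat -> Prop) (g : nat -> nat) : Prop :=
  P g /\ forall a, A a -> g a = a.

Definition clos (P : (nat -> nat) -> Prop) (A : nat -> Prop) (a : nat) : Prop :=
  finN (fun b => exists g, stab P A g /\ g a = b).

Definition locally_finite (P : (nat -> nat) -> Prop) : Prop :=
  forall A, finN A -> finN (clos P A).

Definition img (g : nat -> nat) (A : nat -> Prop) (b : nat) : Prop :=
  exists c, A c /\ b = g c.

Definition k_free (P : (nat -> nat) -> Prop) (k : nat) : Prop :=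
  forall A, finN A ->
    exists gs : nat -> nat -> nat,
      (forall i, (i < k)%N -> P (gs i)) /\
      forall i, (i < k)%N -> forall a,
        ~ (clos P (img (gs i) A) a /\
           clos P (fun b => exists j, (j < k)%N /\ j <> i /\ img (gs j) A b) a).

Definition RN := nat -> R.

Definition ballRN (x : RN) (F : list nat) (e : R) (y : RN) : Prop :=
  forall i, In i F -> Rabs (y i - x i) < e.

Definition openRN (O : RN -> Prop) : Prop :=
  forall x, O x -> exists F e, 0 < e /\ forall y, ballRN x F e y -> O y.

Definition nowhere_dense (A : RN -> Prop) : Prop :=
  forall U, openRN U -> (exists x, U x) ->
    exists V, openRN V /\ (exists x, V x) /\ (forall x, V x -> U x) /\
              (forall x, V x -> ~ A x).

Definition meager (A : RN -> Prop) : Prop :=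
  exists Ns : nat -> RN -> Prop,
    (forall k, nowhere_dense (Ns k)) /\ forall x, A x -> exists k, Ns k x.

Definition comeager (C : RN -> Prop) : Prop := meager (fun x => ~ C x).

Definition baire_property (A : RN -> Prop) : Prop :=
  exists U, openRN U /\ meager (fun x => ~ (A x <-> U x)).

(* E(P): orbit equivalence relation of the Bernoulli shift, (gx)(a) = x(g^-1 a);
   x' = g x  iff  x'(g b) = x b for all b. *)
Definition EP (P : (nat -> nat) -> Prop) (x x' : RN) : Prop :=
  exists g, P g /\ forall b, x' (g b) = x b.

Record language := {
  Rsym : Type;
  Fsym : Type;
  rar : Rsym -> nat;
  far : Fsym -> nat }.
Arguments rar {l} _.
Arguments far {l} _.

Definition countable_language (L : language) : Prop :=
  (exists e : Rsym L -> nat, forall r s, e r = e s -> r = s) /\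
  (exists e : Fsym L -> nat, forall r s, e r = e s -> r = s).

Record structure (L : language) := {
  srel : forall r : Rsym L, ('I_(@rar L r) -> nat) -> Prop;
  sfun : forall f : Fsym L, ('I_(@far L f) -> nat) -> nat }.
Arguments srel {L} _ _ _.
Arguments sfun {L} _ _ _.

Inductive term (L : language) : Type :=
  | Var : nat -> term L
  | App : forall f : Fsym L, ('I_(far f) -> term L) -> term L.
Arguments Var {L} _.
Arguments App {L} _ _.

Inductive formula (L : language) : Type :=
  | FEq : term L -> term L -> formula L
  | FRel : forall r : Rsym L, ('I_(rar r) -> term L) -> formula L
  | FNeg : formula L -> formula L
  | FAnd : formula L -> formula L -> formula L
  | FConj : (nat -> formula L) -> formula L
  | FEx : nat -> formula L -> formula L.
Arguments FEq {L} _ _.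
Arguments FRel {L} _ _.
Arguments FNeg {L} _.
Arguments FAnd {L} _ _.
Arguments FConj {L} _.
Arguments FEx {L} _ _.

Definition upd (s : nat -> nat) (v a : nat) : nat -> nat :=
  fun w => if Nat.eqb w v then a else s w.

Fixpoint eval {L} (N : structure L) (s : nat -> nat) (t : term L) : nat :=
  match t with
  | Var n => s n
  | App f args => sfun N f (fun i => eval N s (args i))
  end.

Fixpoint sat {L} (N : structure L) (s : nat -> nat) (phi : formula L) : Prop :=
  match phi with
  | FEq t u => eval N s t = eval N s u
  | FRel r args => srel N r (fun i => eval N s (args i))
  | FNeg p => ~ sat N s p
  | FAnd p q => sat N s p /\ sat N s q
  | FConj ps => forall k, sat N s (ps k)
  | FEx v p => exists a, sat N (upd s v a) p
  end.

Fixpoint occurs {L} (v : nat) (t : term L) : Prop :=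
  match t with
  | Var n => n = v
  | App f args => exists i, occurs v (args i)
  end.

Fixpoint free {L} (v : nat) (phi : formula L) : Prop :=
  match phi with
  | FEq t u => occurs v t \/ occurs v u
  | FRel r args => exists i, occurs v (args i)
  | FNeg p => free v p
  | FAnd p q => free v p \/ free v q
  | FConj ps => exists k, free v (ps k)
  | FEx w p => v <> w /\ free v p
  end.

(* L_{w1,w} well-formedness: every countable conjunction has finitely many
   free variables (hence so does every subformula). *)
Fixpoint wf {L} (phi : formula L) : Prop :=
  match phi with
  | FEq _ _ => True
  | FRel _ _ => True
  | FNeg p => wf p
  | FAnd p q => wf p /\ wf q
  | FConj ps => (forall k, wf (ps k)) /\
                exists m, forall k v, free v (ps k) -> (v < m)%N
  | FEx _ p => wf p
  end.

Fixpoint first_order {L} (phi : formula L) : Prop :=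
  match phi with
  | FEq _ _ => True
  | FRel _ _ => True
  | FNeg p => first_order p
  | FAnd p q => first_order p /\ first_order q
  | FConj _ => False
  | FEx _ p => first_order p
  end.

Definition is_sentence {L} (sigma : formula L) : Prop :=
  wf sigma /\ forall v, ~ free v sigma.

(* N |= sigma (for a sentence the assignment is irrelevant) *)
Definition models {L} (N : structure L) (sigma : formula L) : Prop :=
  sat N (fun _ => 0%nat) sigma.

Definition acl {L} (N : structure L) (B : nat -> Prop) (b : nat) : Prop :=
  exists (phi : formula L) (x : nat) (s : nat -> nat),
    first_order phi /\
    (forall v, free v phi -> v <> x -> B (s v)) /\
    sat N (upd s x b) phi /\
    finN (fun a => sat N (upd s x a) phi).

Definition injective_seq (x : RN) : Prop := forall a b, x a = x b -> a = b.

Definition in_StrInj {L} (sigma : formula L) (y : RN * structure L) : Prop :=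
  injective_seq (fst y) /\ models (snd y) sigma.

(* (x',N') = g.(x,N) for some g in Sym(N), written with n = g b:
   x'(g b) = x b, N' |= R(g b) <-> N |= R(b), N'(f)(g b) = g (N(f)(b)). *)
Definition iso_rel {L} (y y' : RN * structure L) : Prop :=
  exists g, is_perm g /\
    (forall b, fst y' (g b) = fst y b) /\
    (forall r (bs : 'I_(rar r) -> nat),
        srel (snd y') r (fun i => g (bs i)) <-> srel (snd y) r bs) /\
    (forall f (bs : 'I_(far f) -> nat),
        sfun (snd y') f (fun i => g (bs i)) = g (sfun (snd y) f bs)).

(* Topology on R^N x Str(L, N): product of the product topology and the
   logic topology (basic nbhds: agreement on finitely many atomic facts). *)
Definition agree_on {L} (N N' : structure L)
  (Rs : list {r : Rsym L & 'I_(rar r) -> nat})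
  (Fs : list {f : Fsym L & 'I_(far f) -> nat}) : Prop :=
  (forall p, In p Rs -> (srel N' (projT1 p) (projT2 p) <-> srel N (projT1 p) (projT2 p))) /\
  (forall p, In p Fs -> sfun N' (projT1 p) (projT2 p) = sfun N (projT1 p) (projT2 p)).

Definition open_amb {L} (O : RN * structure L -> Prop) : Prop :=
  forall y, O y -> exists F e Rs Fs, 0 < e /\
    forall y', ballRN (fst y) F e (fst y') -> agree_on (snd y) (snd y') Rs Fs -> O y'.

(* Baire measurability of f : R^N -> Str^inj_R(sigma,N): preimages of open
   sets (of the subspace topology) have the Baire property. *)
Definition baire_measurable {L} (f : RN -> RN * structure L) : Prop :=
  forall O, open_amb O -> baire_property (fun x => O (f x)).

Definition generically_iso_ergodic (P : (nat -> nat) -> Prop)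
  {L} (sigma : formula L) : Prop :=
  forall f : RN -> RN * structure L,
    (forall x, in_StrInj sigma (f x)) ->
    baire_measurable f ->
    (forall x x', EP P x x' -> iso_rel (f x) (f x')) ->
    exists C, comeager C /\ exists y0, forall x, C x -> iso_rel (f x) y0.

(* Main.v *)
Require Import Defs.
From Stdlib Require Import Reals List Lra Lia ZArith Classical IndefiniteDescription FunctionalExtensionality.
From mathcomp Require Import ssreflect ssrfun ssrbool eqtype ssrnat seq choice fintype finfun bigop.

(** Write [f x = (z x, N x)] and let [S x] be the range of [z x], a countable set of reals which,
    with the structure transported from [N x], depends only on the [E(P)]-class of [x].
    Generically [z x m] is continuous in [x], and since [z x m] stays in [S (x o h)] for all [h] in
    [P], a category argument on [R^N x P] shows that locally it depends only on [x] restricted to a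
    finite set [A].  By freeness take [g_0, ..., g_n] spreading [A] into independent copies; the
    reals [r_j = z (x o g_j) m] all lie in [S x], so by the hypothesis on [acl] some [r_i] is, on an
    open set, definable in [S x] from the others.  Moving [x] by elements of [P] that fix the
    closure of the copies [g_j A], [j <> i], then preserves [r_i], so [r_i] depends only on the
    coordinates in that closure, as well as only on the coordinates in [g_i A]; these sets being
    disjoint, [r_i] is locally constant.  Hence [S x] lies generically in one countable set, and
    the countably many facts about the structure on it are invariant, so generically constant. *)

(** * The Baire category theorem on [R^N x P] *)

Lemma list_gap (F : list nat) (u : nat -> R) (e : R) :
  (forall i, In i F -> u i < e) ->
  exists d, 0 < d /\ forall i, In i F -> u i + d <= e.
Proof.
elim: F => [_|i F IH H]; first by exists 1; split=> //; lra.
have [j Fj|d [d0 Hd]] := IH; first by apply: H; right.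
have Hi : u i < e by apply: H; left.
exists (Rmin d (e - u i)); split; first by apply: Rmin_glb_lt; lra.
have := Rmin_l d (e - u i); have := Rmin_r d (e - u i).
by move=> ? ? j [<-|/Hd]; lra.
Qed.

Lemma ballRN_center x F e : 0 < e -> ballRN x F e x.
Proof. by move=> e0 i _; rewrite Rminus_diag Rabs_R0. Qed.

Lemma openRN_ball x F e : openRN (ballRN x F e).
Proof.
move=> y By; have [d [d0 Hd]] := list_gap F (fun i => Rabs (y i - x i)) e By.
exists F, d; split=> // z Bz i Fi.
have := Rabs_triang (z i - y i) (y i - x i).
have -> : z i - y i + (y i - x i) = z i - x i by ring.
have := Hd i Fi; have := Bz i Fi; lra.
Qed.

Lemma openRN_and U V : openRN U -> openRN V -> openRN (fun x => U x /\ V x).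
Proof.
move=> oU oV x [Ux Vx].
have [F [e [e0 HF]]] := oU x Ux; have [F' [e' [e0' HF']]] := oV x Vx.
exists (F ++ F')%list, (Rmin e e'); split; first exact: Rmin_glb_lt.
have := Rmin_l e e'; have := Rmin_r e e' => ? ? y By.
split; [apply: HF|apply: HF'] => i Fi.
- by have := By i (in_or_app F F' i (or_introl Fi)); lra.
- by have := By i (in_or_app F F' i (or_intror Fi)); lra.
Qed.

Lemma openRN_ex (T : Type) (U : T -> RN -> Prop) :
  (forall t, openRN (U t)) -> openRN (fun x => exists t, U t x).
Proof.
move=> oU x [t Ux]; have [F [e [e0 HF]]] := oU t x Ux.
by exists F, e; split=> // y /HF; exists t.
Qed.

Lemma openRN_forall (T : finType) (U : T -> RN -> Prop) :
  (forall t, openRN (U t)) -> openRN (fun x => forall t, U t x).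
Proof.
move=> oU; suff H (s : seq T) : openRN (fun x => forall t, t \in s -> U t x).
  move=> x Ux; have [F [e [e0 HF]]] := H (enum T) x (fun t _ => Ux t).
  by exists F, e; split=> // y /HF Uy t; apply: Uy; rewrite mem_enum.
elim: s => [|t s IH] x Hx; first by exists nil, 1; split=> //; lra.
have Ux : U t x /\ forall t', t' \in s -> U t' x.
  by split=> [|t' st']; apply: Hx; rewrite inE ?eqxx // st' orbT.
have [F [e [e0 HF]]] := openRN_and _ _ (oU t) IH x Ux.
by exists F, e; split=> // y /HF[Uy Hy] t'; rewrite inE => /orP[/eqP->|/Hy].
Qed.

Lemma openRN_const (A : Prop) : openRN (fun _ => A).
Proof. by move=> x a; exists nil, 1; split=> //; lra. Qed.

(** This is the Bernoulli shift by the inverse of [g], hence a right action: [act (act x k) h]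
    precomposes [x] with [k] after [h]. *)
Definition act (x : RN) (g : nat -> nat) : RN := fun a => x (g a).

Lemma openRN_act g O : openRN O -> openRN (fun x => O (act x g)).
Proof.
move=> oO x Ox; have [F [e [e0 HF]]] := oO _ Ox.
exists (List.map g F), e; split=> // y By; apply: HF => i Fi.
by apply: By; apply: in_map.
Qed.

Lemma nowhere_dense_set0 : nowhere_dense (fun _ => False).
Proof. by move=> U oU exU; exists U; do !split=> //; move=> ? ? []. Qed.

Lemma meager_sub A B : (forall x, A x -> B x) -> meager B -> meager A.
Proof. by move=> AB [Ns [H1 H2]]; exists Ns; split=> // x /AB/H2. Qed.

Lemma meager_ex_nat (A : nat -> RN -> Prop) :
  (forall k, meager (A k)) -> meager (fun x => exists k, A k x).
Proof.
move=> /functional_choice[Ns HN].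
exists (fun c => if unpickle c is Some (k, j) then Ns k j else fun _ => False); split.
- move=> c; case: (unpickle c) => [[k j]|]; first by have [] := HN k.
  exact: nowhere_dense_set0.
- move=> x [k Akx]; have [_ /(_ x Akx)[j Nx]] := HN k.
  by exists (pickle (k, j)); rewrite pickleK.
Qed.

Lemma meager_ex (T : countType) (A : T -> RN -> Prop) :
  (forall t, meager (A t)) -> meager (fun x => exists t, A t x).
Proof.
move=> H; apply: (@meager_sub _ (fun x => exists c, if unpickle c is Some t then A t x else False)).
- by move=> x [t At]; exists (pickle t); rewrite pickleK.
- apply: meager_ex_nat => c; case: (unpickle c) => [t|]; first exact: H.
  by exists (fun _ _ => False); split=> // k; apply: nowhere_dense_set0.
Qed.

Lemma comeager_sub A B : (forall x, A x -> B x) -> comeager A -> comeager B.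
Proof. by move=> AB; apply: meager_sub => x nB /AB. Qed.

Lemma comeager_all (T : countType) (A : T -> RN -> Prop) :
  (forall t, comeager (A t)) -> comeager (fun x => forall t, A t x).
Proof.
move=> H; apply: meager_sub (meager_ex _ _ H) => x nA.
by apply: NNPP => nE; apply: nA => t; apply: NNPP => nt; apply: nE; exists t.
Qed.

Lemma comeager_and A B : comeager A -> comeager B -> comeager (fun x => A x /\ B x).
Proof.
move=> cA cB.
apply: (@comeager_sub (fun x => forall b : bool, if b then A x else B x)).
- by move=> x H; split; [apply: (H true)|apply: (H false)].
- by apply: (comeager_all _ (fun b x => if b then A x else B x)); case.
Qed.

Lemma comeager_True A : (forall x, A x) -> comeager A.
Proof.
move=> HA; exists (fun _ _ => False); split; first by move=> k; apply: nowhere_dense_set0.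
by move=> x /(_ (HA x)).
Qed.

Lemma meager_act g A : is_perm g -> meager A -> meager (fun x => A (act x g)).
Proof.
move=> [h [hg gh]] [Ns [H1 H2]].
exists (fun k x => Ns k (act x g)); split; last by move=> x /H2.
move=> k U oU [x Ux].
have actK y : act (act y h) g = y by apply: functional_extensionality => a; rewrite /act hg.
have actK' y : act (act y g) h = y by apply: functional_extensionality => a; rewrite /act gh.
have [|V [oV [[y Vy] [VU VN]]]] := H1 k (fun y => U (act y h)) (openRN_act h U oU).
  by exists (act x g); rewrite actK'.
exists (fun x => V (act x g)); split; first exact: openRN_act.
split; first by exists (act y h); rewrite actK.
by split=> z Vz; [rewrite -(actK' z); apply: VU|apply: VN].
Qed.

Lemma comeager_act g A : is_perm g -> comeager A -> comeager (fun x => A (act x g)).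
Proof. by move=> pg; apply: (meager_act g (fun x => ~ A x)). Qed.

Definition denseRN (D : RN -> Prop) : Prop :=
  forall U, openRN U -> (exists x, U x) -> exists x, U x /\ D x.

Lemma comeager_open_dense D : openRN D -> denseRN D -> comeager D.
Proof.
move=> oD dD; exists (fun _ x => ~ D x); split; last by move=> x nD; exists 0%nat.
move=> _ U oU exU; exists (fun x => U x /\ D x).
by split; [apply: openRN_and|split; [apply: dD|split=> x []]] => // _ Dx; apply.
Qed.

Lemma comeager_dense_opens C : comeager C ->
  exists D : nat -> RN -> Prop, (forall k, openRN (D k)) /\ (forall k, denseRN (D k)) /\
    forall x, (forall k, D k x) -> C x.
Proof.
move=> [Ns [H1 H2]].
exists (fun k x => exists V, (openRN V /\ forall y, V y -> ~ Ns k y) /\ V x); split; last split.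
- move=> k x [V [[oV VN] Vx]]; have [F [e [e0 HF]]] := oV x Vx.
  by exists F, e; split=> // y /HF Vy; exists V.
- move=> k U oU /(H1 k U oU)[V [oV [[x Vx] [VU VN]]]].
  by exists x; split; [apply: VU|exists V].
- move=> x HD; apply: NNPP => nC; have [k Nkx] := H2 x nC.
  by have [V [[_ VN] Vx]] := HD k; apply: (VN x).
Qed.

Definition agree (F : list nat) (g h : nat -> nat) : Prop :=
  forall a, In a F -> h a = g a.

Section ProductBaire.
Variables (P : (nat -> nat) -> Prop) (HP : closed_perm_group P).

(** Says that [D] contains a dense open subset of R^N x P. One list [F] serves both factors: the
    coordinates of [x] controlled up to [e], and the arguments at which [h] is prescribed. *)
Definition dense_interiorXP (D : RN -> (nat -> nat) -> Prop) : Prop :=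
  forall x h F e, P h -> 0 < e ->
    exists x' h' F' e', [/\ P h', ballRN x F e x', agree F h h', 0 < e' &
      forall x'' h'', P h'' -> ballRN x' F' e' x'' -> agree F' h' h'' -> D x'' h''].

Definition stage := (RN * (nat -> nat) * (list nat * R))%type.
Definition st_x (s : stage) : RN := s.1.1.
Definition st_h (s : stage) : nat -> nat := s.1.2.
Definition st_F (s : stage) : list nat := s.2.1.
Definition st_e (s : stage) : R := s.2.2.

Definition refines (s s' : stage) : Prop :=
  agree (st_F s) (st_h s) (st_h s') /\ incl (st_F s) (st_F s') /\
  forall i, In i (st_F s) -> Rabs (st_x s' i - st_x s i) + st_e s' <= st_e s.

Definition valid (s : stage) : Prop := P (st_h s) /\ 0 < st_e s.

(** A stage codes a basic neighbourhood. Putting [j] into [st_F s] and among the values of [st_h s]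
    on it makes the limit permutation total and surjective; the weak inequality survives passage to
    the limit. *)
Definition decides (D : RN -> (nat -> nat) -> Prop) (j : nat) (s : stage) : Prop :=
  In j (st_F s) /\ (exists a, In a (st_F s) /\ st_h s a = j) /\
  forall x h, P h -> (forall i, In i (st_F s) -> Rabs (x i - st_x s i) <= st_e s) ->
    agree (st_F s) (st_h s) h -> D x h.

Lemma refines_refl s : refines s s.
Proof. by split; [|split]=> // i _; rewrite Rminus_diag Rabs_R0; lra. Qed.

Lemma refines_trans s t u : refines s t -> refines t u -> refines s u.
Proof.
move=> [A1 [I1 B1]] [A2 [I2 B2]]; split; last split.
- by move=> a Fa; rewrite A2 ?A1 //; apply: I1.
- by move=> a /I1/I2.
- move=> i Fi; have := B1 i Fi; have := B2 i (I1 i Fi).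
  have := Rabs_triang (st_x u i - st_x t i) (st_x t i - st_x s i).
  have -> : st_x u i - st_x t i + (st_x t i - st_x s i) = st_x u i - st_x s i by ring.
  by lra.
Qed.

Lemma dense_interiorXP_and D D' : dense_interiorXP D -> dense_interiorXP D' ->
  dense_interiorXP (fun x h => D x h /\ D' x h).
Proof.
move=> dD dD' x h F e Ph e0.
have [x1 [h1 [F1 [e1 [Ph1 B1 A1 e10 H1]]]]] := dD x h F e Ph e0.
have [d [d0 Hd]] := list_gap F (fun i => Rabs (x1 i - x i)) e B1.
have m1 := Rmin_l d e1; have m2 := Rmin_r d e1.
have [|x2 [h2 [F2 [e2 [Ph2 B2 A2 e20 H2]]]]] := dD' x1 h1 (F ++ F1)%list (Rmin d e1) Ph1.
  exact: Rmin_glb_lt.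
have [d' [d0' Hd']] := list_gap (F ++ F1) (fun i => Rabs (x2 i - x1 i)) (Rmin d e1) B2.
have m1' := Rmin_l d' e2; have m2' := Rmin_r d' e2.
have FF i : In i F -> In i (F ++ F1)%list by move=> ?; apply: in_or_app; left.
have FF1 i : In i F1 -> In i (F ++ F1)%list by move=> ?; apply: in_or_app; right.
exists x2, h2, (F ++ F1 ++ F2)%list, (Rmin d' e2); split=> //.
- move=> i Fi; have := Hd i Fi; have := B2 i (FF i Fi).
  have := Rabs_triang (x2 i - x1 i) (x1 i - x i).
  have -> : x2 i - x1 i + (x1 i - x i) = x2 i - x i by ring.
  by lra.
- by move=> a Fa; rewrite A2 ?A1 //; apply: FF.
- exact: Rmin_glb_lt.
move=> x3 h3 Ph3 B3 A3; split.
- apply: H1 => // [i Fi|a Fa]; last first.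
    by rewrite A3 ?A2 //; [apply: FF1|apply: in_or_app; right; apply: in_or_app; left].
  have := Hd' i (FF1 i Fi).
  have := B3 i (in_or_app F _ i (or_intror (in_or_app F1 F2 i (or_introl Fi)))).
  have := Rabs_triang (x3 i - x2 i) (x2 i - x1 i).
  have -> : x3 i - x2 i + (x2 i - x1 i) = x3 i - x1 i by ring.
  by lra.
- apply: H2 => // [i Fi|a Fa]; last first.
    by rewrite A3 //; apply: in_or_app; right; apply: in_or_app; right.
  have := B3 i (in_or_app F _ i (or_intror (in_or_app F1 F2 i (or_intror Fi)))).
  by lra.
Qed.

Lemma refine_step D j s : dense_interiorXP D -> valid s ->
  exists s', valid s' /\ refines s s' /\ decides D j s'.
Proof.
case: s => [[x h] [F e]] dD [/= Ph e0].
have [x1 [h1 [F1 [e1 [Ph1 B1 A1 e10 H1]]]]] := dD x h F e Ph e0.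
have [d [d0 Hd]] := list_gap F (fun i => Rabs (x1 i - x i)) e B1.
have [Hperm _] := HP; have [k [kh hk]] := Hperm h1 Ph1.
have m1 := Rmin_l d (e1 / 2); have m2 := Rmin_r d (e1 / 2).
(* [k j] is the preimage of [j] under [h1]; halving [e1] fits the closed ball of the new stage into
   the open ball on which [D] holds. *)
exists (x1, h1, (F ++ j :: k j :: F1, Rmin d (e1 / 2)))%list; split.
  by split=> //=; apply: Rmin_glb_lt; lra.
split; [split; [|split]|split; [|split]]; rewrite /st_x /st_h /st_F /st_e /=.
- exact: A1.
- by move=> a Fa; apply: in_or_app; left.
- by move=> i /Hd; rewrite /st_x /=; lra.
- by apply: in_or_app; right; left.
- by exists (k j); split=> //; apply: in_or_app; right; right; left.
- move=> x' h' Ph' B' A'; apply: H1 => // i Fi.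
  + have : In i (F ++ j :: k j :: F1)%list by apply: in_or_app; right; right; right.
    by move=> /B'; lra.
  + by apply: A'; apply: in_or_app; right; right; right.
Qed.

Section Limit.
Variables (S : nat -> stage) (D : nat -> RN -> (nat -> nat) -> Prop).
Hypotheses (vS : forall j, valid (S j)) (rS : forall j, refines (S j) (S j.+1))
  (dS : forall j, decides (D j) j (S j.+1)).

Lemma stage_mono j k : (j <= k)%N -> refines (S j) (S k).
Proof.
elim: k => [|k IH]; first by rewrite leqn0 => /eqP->; apply: refines_refl.
rewrite leq_eqVlt => /orP[/eqP->|/IH H]; first exact: refines_refl.
exact: refines_trans H (rS k).
Qed.

Lemma stage_In a j : (a < j)%N -> In a (st_F (S j)).
Proof. by move=> /stage_mono[_ [I _]]; apply: I; have [] := dS a. Qed.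

Lemma stage_h_coherent a j k : In a (st_F (S j)) -> In a (st_F (S k)) ->
  st_h (S j) a = st_h (S k) a.
Proof.
move=> Ij Ik; have [A1 _] := stage_mono _ _ (leq_maxl j k).
have [A2 _] := stage_mono _ _ (leq_maxr j k).
by rewrite -A1 // -A2.
Qed.

Lemma stage_limit_x i : exists l, forall j, In i (st_F (S j)) ->
  Rabs (l - st_x (S j) i) <= st_e (S j).
Proof.
have cross j k : In i (st_F (S j)) -> In i (st_F (S k)) ->
  st_x (S j) i - st_e (S j) <= st_x (S k) i + st_e (S k).
  move=> Ij Ik; have [_ [_ /(_ i Ij) B1]] := stage_mono _ _ (leq_maxl j k).
  have [_ [_ /(_ i Ik) B2]] := stage_mono _ _ (leq_maxr j k).
  have [_] := vS (maxn j k); move: B1 B2; rewrite /Rabs.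
  by case: Rcase_abs; case: Rcase_abs => *; lra.
(* The intervals around [st_x (S j) i] pairwise meet by [cross], so the supremum of their left ends
   lies in all of them. *)
have [||l [ub lub]] := completeness
  (fun r => exists j, In i (st_F (S j)) /\ r = st_x (S j) i - st_e (S j)).
- exists (st_x (S i.+1) i + st_e (S i.+1)) => r [j [Ij ->]].
  by apply: cross => //; apply: stage_In.
- by exists (st_x (S i.+1) i - st_e (S i.+1)), i.+1; split=> //; apply: stage_In.
exists l => j Ij; apply: Rabs_le; split.
- by have := ub (st_x (S j) i - st_e (S j)) (ex_intro _ j (conj Ij erefl)); lra.
- have : l <= st_x (S j) i + st_e (S j) by apply: lub => r [k [Ik ->]]; apply: cross.
  by lra.
Qed.

(** Finite agreement with members of [P] gives injectivity of the pointwise limit, [decides] gives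
    surjectivity, and closedness of [P] puts the limit in [P]. *)
Lemma stage_limit_h : exists h, P h /\ forall j, agree (st_F (S j)) (st_h (S j)) h.
Proof.
pose h a := st_h (S a.+1) a.
have hS j : agree (st_F (S j)) (st_h (S j)) h.
  by move=> a Fa; apply: stage_h_coherent => //; apply: stage_In.
have inj a b : h a = h b -> a = b.
  have Ia : In a (st_F (S (maxn a b).+1)) by apply: stage_In; rewrite ltnS leq_maxl.
  have Ib : In b (st_F (S (maxn a b).+1)) by apply: stage_In; rewrite ltnS leq_maxr.
  rewrite (hS _ a Ia) (hS _ b Ib).
  have [Pj _] := vS (maxn a b).+1; have [Hperm _] := HP.
  by have [k [kh _]] := Hperm _ Pj; move=> /(f_equal k); rewrite !kh.
have surj b : exists a, h a = b.
  by have [_ [[a [Fa ha]] _]] := dS b; exists a; rewrite (hS _ a Fa).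
exists h; split=> //; have [_ [_ [_ [_ cl]]]] := HP; apply: cl.
- have [k hk] := functional_choice _ surj.
  by exists k; split=> // a; apply: inj; rewrite hk.
- move=> m; exists (st_h (S m)); split; first by have [] := vS m.
  by move=> a am; rewrite (hS m) //; apply: stage_In.
Qed.

Lemma stage_limit x0 h0 F0 e0 : refines (x0, h0, (F0, e0)) (S 0%nat) ->
  exists x h, P h /\ (forall i, In i F0 -> Rabs (x i - x0 i) <= e0) /\ agree F0 h0 h /\
    forall j, D j x h.
Proof.
move=> r0; have [x Hx] := functional_choice _ stage_limit_x.
have [h [Ph Hh]] := stage_limit_h.
have [A0 [I0 B0]] := r0; exists x, h; split=> //; split; last split.
- move=> i /[dup] Fi /I0/Hx; have := B0 i Fi.
  have := Rabs_triang (x i - st_x (S 0%nat) i) (st_x (S 0%nat) i - x0 i).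
  have -> : x i - st_x (S 0%nat) i + (st_x (S 0%nat) i - x0 i) = x i - x0 i by ring.
  by rewrite /st_x /st_e /=; lra.
- by move=> a Fa; rewrite (Hh 0%nat) ?A0 //; apply: I0.
- by move=> j; have [_ [_ H]] := dS j; apply: H => // i; apply: Hx.
Qed.

End Limit.

Theorem product_baire (D : nat -> RN -> (nat -> nat) -> Prop) x h F e :
  (forall k, dense_interiorXP (D k)) -> P h -> 0 < e ->
  exists x' h', P h' /\ ballRN x F e x' /\ agree F h h' /\ forall k, D k x' h'.
Proof.
move=> dD Ph e0.
have step (js : nat * stage) : exists s', valid js.2 ->
    valid s' /\ refines js.2 s' /\ decides (D js.1) js.1 s'.
  (* Invalid stages are sent to themselves, only to make the choice function total. *)
  have [v|nv] := classic (valid js.2); last by exists js.2.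
  by have [s' Hs'] := refine_step (D js.1) js.1 js.2 (dD _) v; exists s'.
have [f Hf] := functional_choice _ step.
(* The radius is halved because the limit obeys weak inequalities while [ballRN] is strict. *)
pose s0 : stage := (x, h, (F, e / 2)).
pose S := fix S j := if j is j'.+1 then f (j', S j') else s0.
have v j : valid (S j).
  elim: j => [|j IH]; first by split=> //; rewrite /st_e /=; lra.
  by have [] := Hf (j, S j) IH.
have [||x' [h' [Ph' [B [A HD]]]]] := stage_limit S D v _ _ x h F (e / 2) (refines_refl _).
- by move=> j; have [_ []] := Hf (j, S j) (v j).
- by move=> j; have [_ []] := Hf (j, S j) (v j).
by exists x', h'; do !split=> //; move=> i /B; lra.
Qed.

End ProductBaire.

(** With the trivial group the second factor is a point, and [product_baire] becomes the Baire
    category theorem for R^N. *)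
Lemma closed_perm_group_trivial : closed_perm_group (fun g => forall a, g a = a).
Proof.
split; first by move=> g Hg; exists (fun a => a).
split=> //; split; first by move=> g h Hg Hh a; rewrite Hh Hg.
split; first by move=> g Hg; exists (fun a => a).
by move=> g _ H a; have [h [Hh /(_ a (ltnSn a)) <-]] := H a.+1.
Qed.

Theorem baire C U : comeager C -> openRN U -> (exists x, U x) -> exists x, U x /\ C x.
Proof.
move=> /comeager_dense_opens[D [oD [dD DC]]] oU [x0 Ux0].
have [F [e [e0 HF]]] := oU x0 Ux0.
have [||x [_ [_ [B [_ HD]]]]] := product_baire _ closed_perm_group_trivial
  (fun k x _ => D k x) x0 (fun a => a) F e _ _ e0.
- move=> k x h F' e' Hh e0'.
  have [|x' [Bx' Dx']] := dD k _ (openRN_ball x F' e'); first by exists x; apply: ballRN_center.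
  have [F1 [e1 [e10 H1]]] := oD k x' Dx'.
  by exists x', h, F1, e1; split=> // x'' h'' _ /H1.
- by [].
by exists x; split; [apply: HF|apply: DC].
Qed.

(** * The Baire property and a countable base *)

Lemma baire_property_ext A B : (forall x, A x <-> B x) -> baire_property A -> baire_property B.
Proof.
move=> AB [U [oU mU]]; exists U; split=> //.
by apply: meager_sub mU => x nB; rewrite AB.
Qed.

Lemma baire_property_not A : baire_property A -> baire_property (fun x => ~ A x).
Proof.
move=> [U [oU cU]].
(* [V] is the exterior of [U]; their union is open dense, so off a meagre set the complement of [A]
   is [V]. *)
pose V x := exists W, (openRN W /\ forall y, W y -> ~ U y) /\ W x.
have oV : openRN V.
  move=> x [W [[oW WU] Wx]]; have [F [e [e0 HF]]] := oW x Wx.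
  by exists F, e; split=> // y /HF Wy; exists W.
have cD : comeager (fun x => U x \/ V x).
  apply: comeager_open_dense.
  - move=> x [/oU|/oV] [F [e [e0 HF]]]; exists F, e; split=> // y /HF; by [left|right].
  - move=> W oW [x Wx]; have [[y [Wy Uy]]|H] := classic (exists y, W y /\ U y).
      by exists y; split=> //; left.
    exists x; split=> //; right; exists W; split=> //; split=> // y Wy Uy.
    by apply: H; exists y.
exists V; split=> //; apply: (comeager_sub _ _ _ (comeager_and _ _ cU cD)) => x [AU UV].
split=> [nA|[W [[_ WU] Wx]] /AU]; last exact: WU.
by case: UV => // /AU.
Qed.

Lemma baire_property_ex (T : countType) (A : T -> RN -> Prop) :
  (forall t, baire_property (A t)) -> baire_property (fun x => exists t, A t x).
Proof.
move=> H; have [U HU] := functional_choice _ H.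
exists (fun x => exists t, U t x); split; first by apply: openRN_ex => t; have [] := HU t.
apply: (comeager_sub (fun x => forall t, A t x <-> U t x)).
  by move=> x AU; split=> - [t /AU]; exists t.
by apply: comeager_all => t; have [] := HU t.
Qed.

Lemma baire_property_all (T : countType) (A : T -> RN -> Prop) :
  (forall t, baire_property (A t)) -> baire_property (fun x => forall t, A t x).
Proof.
move=> H; apply: baire_property_ext (baire_property_not _
  (baire_property_ex _ (fun t x => ~ A t x) (fun t => baire_property_not _ (H t)))) => x.
split=> [nE t|At [t]]; last by apply.
by apply: NNPP => nA; apply: nE; exists t.
Qed.

Lemma baire_property_and A B :
  baire_property A -> baire_property B -> baire_property (fun x => A x /\ B x).
Proof.
move=> bA bB; apply: (baire_property_ext (fun x => forall b : bool, if b then A x else B x)).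
- by move=> x; split=> [H|[? ?] []//]; split; [apply: (H true)|apply: (H false)].
- by apply: (baire_property_all _ (fun b x => if b then A x else B x)); case.
Qed.

Lemma baire_property_const (A : Prop) : baire_property (fun _ => A).
Proof.
exists (fun _ => A); split; first exact: openRN_const.
by apply: comeager_True.
Qed.

Lemma baire_property_act g A : is_perm g ->
  baire_property A -> baire_property (fun x => A (act x g)).
Proof.
move=> pg [U [oU cU]]; exists (fun x => U (act x g)).
by split; [apply: openRN_act|apply: (comeager_act g (fun x => A x <-> U x))].
Qed.

Definition qcode := (nat * nat * nat)%type.

(** Rationals are written as a difference over a successor, so that the codes form a countable type
    and the denominator is never zero. *)
Definition qval (c : qcode) : R := (INR c.1.1 - INR c.1.2) / (INR c.2 + 1).

Lemma qval_between a b : a < b -> exists c, a < qval c < b.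
Proof.
move=> ab; have [d Hd] := INR_unbounded (/ (b - a)).
have d0 : 0 < INR d + 1 by have := pos_INR d; lra.
have Hd1 : 1 < (b - a) * (INR d + 1).
  rewrite -[X in X < _](Rinv_r (b - a)); last by lra.
  by apply: Rmult_lt_compat_l; lra.
have [u1 u2] := archimed (a * (INR d + 1)).
move: (up _) u1 u2 => z u1 u2.
have [m [k Hmk]] : exists m k, INR m - INR k = IZR z.
  exists (Z.to_nat z), (Z.to_nat (- z)).
  rewrite !INR_IZR_INZ -minus_IZR; f_equal.
  lia.
exists (m, k, d); rewrite /qval /= Hmk; split.
- by apply: (Rmult_lt_reg_r (INR d + 1)) => //; rewrite /Rdiv Rmult_assoc Rinv_l; lra.
- by apply: (Rmult_lt_reg_r (INR d + 1)) => //; rewrite /Rdiv Rmult_assoc Rinv_l; lra.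
Qed.

Definition bcode := seq (nat * qcode * qcode).

Definition box (c : bcode) (x : RN) : Prop :=
  forall i p q, In (i, p, q) c -> qval p < x i < qval q.

Lemma openRN_coord i p q : openRN (fun x => p < x i < q).
Proof.
move=> x [px xq]; exists (i :: nil)%list, (Rmin (x i - p) (q - x i)).
split; first by apply: Rmin_glb_lt; lra.
have := Rmin_l (x i - p) (q - x i); have := Rmin_r (x i - p) (q - x i) => m1 m2 y By.
by have := By i (or_introl erefl); rewrite /Rabs; case: Rcase_abs => *; lra.
Qed.

Lemma box_cons i p q c x : box ((i, p, q) :: c) x <-> qval p < x i < qval q /\ box c x.
Proof.
split=> [H|[H Hc] j p' q' [[<- <- <-]|/Hc]//].
by split=> [|j p' q' Hj]; apply: H; [left|right].
Qed.

Lemma openRN_box c : openRN (box c).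
Proof.
elim: c => [|[[i p] q] c IH]; first by move=> x _; exists nil, 1; split=> //; lra.
move=> x /box_cons Hx.
have [F [e [e0 HF]]] := openRN_and _ _ (openRN_coord i (qval p) (qval q)) IH x Hx.
by exists F, e; split=> // y /HF/box_cons.
Qed.

Lemma box_nbhd O x : openRN O -> O x -> exists c, box c x /\ forall y, box c y -> O y.
Proof.
move=> oO Ox; have [F [e [e0 HF]]] := oO x Ox.
suff [c [cx Hc]] : exists c, box c x /\ forall y, box c y -> ballRN x F e y.
  by exists c; split=> // y /Hc/HF.
elim: {HF} F => [|i F [c [cx Hc]]]; first by exists nil; split=> // y _ i [].
have [p Hp] := qval_between (x i - e) (x i) ltac:(lra).
have [q Hq] := qval_between (x i) (x i + e) ltac:(lra).
exists ((i, p, q) :: c); split; first by apply/box_cons; split=> //; lra.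
move=> y /box_cons[Hi /Hc By] j [<-|/By//].
by rewrite /Rabs; case: Rcase_abs => *; lra.
Qed.

(** * Relations between generic points *)

Definition generically (E : RN -> RN -> Prop) : Prop :=
  exists C, comeager C /\ forall x y, C x -> C y -> E x y.

Lemma generically_all (T : Type) (e : T -> nat) (E : T -> RN -> RN -> Prop) :
  injective e -> (forall t, generically (E t)) -> generically (fun x y => forall t, E t x y).
Proof.
move=> e_inj /functional_choice[C HC].
exists (fun x => forall k t, e t = k -> C t x); split.
  apply: comeager_all => k; have [[t et]|nE] := classic (exists t, e t = k).
    have [Ct _] := HC t; apply: comeager_sub Ct => x Cx u.
    by rewrite -et => /e_inj->.
  by apply: comeager_True => x t et; case: nE; exists t.
move=> x y Cx Cy t; have [_ H] := HC t.
by apply: H; [apply: (Cx (e t))|apply: (Cy (e t))].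
Qed.

Lemma generically_and E F :
  generically E -> generically F -> generically (fun x y => E x y /\ F x y).
Proof.
move=> [C [cC HC]] [D [cD HD]]; exists (fun x => C x /\ D x); split.
  exact: comeager_and.
by move=> x y [Cx Dx] [Cy Dy]; split; [apply: HC|apply: HD].
Qed.

(** * Finite orbits and algebraic closure *)

Lemma list_filter (T : Type) (Q : T -> Prop) (l : list T) :
  exists l', forall a, In a l' <-> In a l /\ Q a.
Proof.
elim: l => [|b l [l' Hl']]; first by exists nil => a; split=> [[]|[]].
have [Qb|nQb] := classic (Q b).
- exists (b :: l')%list => a; split=> [[<-|/Hl'[la Qa]]|[[<-|la] Qa]].
  + by split=> //; left.
  + by split=> //; right.
  + by left.
  + by right; apply/Hl'.
- exists l' => a; split=> [/Hl'[la Qa]|[[ba|la] Qa]].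
  + by split=> //; right.
  + by case: nQb; rewrite ba.
  + by apply/Hl'.
Qed.

Definition perm_group (H : (nat -> nat) -> Prop) : Prop :=
  H (fun a => a) /\
  (forall g h, H g -> H h -> H (fun a => g (h a))) /\
  (forall g, H g -> exists h, H h /\ (forall a, h (g a) = a) /\ (forall a, g (h a) = a)).

Lemma closed_perm_group_group P : closed_perm_group P -> perm_group P.
Proof. by move=> [_ [H1 [H2 [H3 _]]]]. Qed.

Lemma perm_group_stab H A : perm_group H -> perm_group (stab H A).
Proof.
move=> [H1 [HM HV]]; split; first by [].
split; first by move=> g h [Hg gA] [Hh hA]; split=> [|a Aa]; [apply: HM|rewrite hA // gA].
move=> g [Hg gA]; have [h [Hh [hg gh]]] := HV g Hg; exists h; split=> //.
by split=> // a Aa; rewrite -{1}(gA a Aa) hg.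
Qed.

(** [clos P A] unfolds to [finite_orbit (stab P A)], so closures are treated as finite orbits of
    groups. *)
Definition finite_orbit (H : (nat -> nat) -> Prop) (a : nat) : Prop :=
  finN (fun b => exists g, H g /\ g a = b).

(* B. H. Neumann's covering lemma for the cosets {h | h a = b}: if these covered H,
   translating the part of the cover that misses a value c of the infinite orbit of a
   would give a cover of H avoiding the point a altogether. *)
Lemma neumann H (A : list nat) : perm_group H ->
  (forall a, In a A -> ~ finite_orbit H a) ->
  forall l : list (nat * nat), (forall p, In p l -> In p.1 A) ->
    exists h, H h /\ forall a b, In (a, b) l -> h a <> b.
Proof.
move=> [H1 [HM HV]]; elim: A => [|a A IH] HA l lA.
  by exists (fun a => a); split=> // a b /lA.
have [g0 [Hg0 Hc]] : exists g0, H g0 /\ ~ In (a, g0 a) l.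
  apply: NNPP => nE; apply: (HA a (or_introl erefl)).
  exists (List.map snd l) => b [g [Hg <-]].
  apply: NNPP => nI; apply: nE; exists g; split=> // Il; apply: nI.
  exact: (in_map snd l (a, g a)).
have Hst b : exists st : (nat -> nat) * (nat -> nat), (exists g, H g /\ g a = b) ->
    H st.1 /\ st.1 b = g0 a /\ forall y, st.2 (st.1 y) = y.
  have [[g [Hg gb]]|nE] := classic (exists g, H g /\ g a = b); last first.
    by exists (id, id) => /nE.
  have [g' [Hg' [g'g _]]] := HV g Hg.
  have [t [_ [ts _]]] := HV _ (HM g0 g' Hg0 Hg').
  exists (fun y => g0 (g' y), t) => _ /=; split; first exact: HM.
  by rewrite -gb g'g.
have [f Hf] := functional_choice _ Hst.
have [l1 Hl1] := list_filter _ (fun p => p.1 <> a) l.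
(* Avoiding the second half of [l2] means that [h] followed by any of the translations still avoids
   [l1]; so if [h] sends [a] to a forbidden [b], the translation taking [b] to [g0 a] repairs it. *)
pose l2 := (l1 ++ List.flat_map (fun b => List.map (fun p => (p.1, (f b).2 p.2)) l1) (List.map snd l))%list.
have l1A p : In p l1 -> In p.1 A by move=> /Hl1[/lA[->|]].
have [|h [Hh Hav]] := IH (fun b Ab => HA b (or_intror Ab)) l2.
  move=> p /in_app_iff[/l1A//|/in_flat_map[b [_ Ip]]].
  by case/in_map_iff: Ip => q [<- /l1A].
have [[b [Ib hb]]|nE] := classic (exists b, In (a, b) l /\ h a = b); last first.
  exists h; split=> // a' b' Il; have [aa|na] := classic (a' = a).
    by rewrite aa => hb; apply: nE; exists b'; rewrite -{1}aa.
  by apply: Hav; apply: in_or_app; left; apply/Hl1.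
have [Hs [sb ts]] := Hf b (ex_intro _ h (conj Hh hb)).
exists (fun y => (f b).1 (h y)); split; first exact: HM.
move=> a' b' Il; have [aa|na] := classic (a' = a).
  by rewrite aa hb sb => cb; apply: Hc; rewrite cb -aa.
move=> E; apply: (Hav a' ((f b).2 b')); last by rewrite -E ts.
apply: in_or_app; right; apply/in_flat_map; exists b; split.
  exact: (in_map snd l (a, b)).
by apply/in_map_iff; exists (a', b'); split=> //; apply/Hl1.
Qed.

Lemma finite_orbit_sub (H K : (nat -> nat) -> Prop) a :
  (forall g, K g -> H g) -> finite_orbit H a -> finite_orbit K a.
Proof. by move=> KH [l Hl]; exists l => b [g [/KH Hg gb]]; apply: Hl; exists g. Qed.

(** For each [b] in the finite orbit of [e] choose [g] in [H] with [g e = b]; finitely many such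
    translates of the orbit of [a] under the stabilizer of [e] cover its orbit under [H]. *)
Lemma finite_orbit_stab1 H e a : perm_group H -> finite_orbit H e ->
  finite_orbit (stab H (fun b => b = e)) a -> finite_orbit H a.
Proof.
move=> [H1 [HM HV]] [l Hl] [l1 Hl1].
have Hg b : exists gg : (nat -> nat) * (nat -> nat), (exists g, H g /\ g e = b) ->
    H gg.2 /\ gg.2 b = e /\ forall y, gg.1 (gg.2 y) = y.
  have [[g [Hg gb]]|nE] := classic (exists g, H g /\ g e = b); last first.
    by exists (id, id) => /nE.
  have [g' [Hg' [g'g gg']]] := HV g Hg.
  by exists (g, g') => _ /=; split=> //; rewrite -gb.
have [f Hf] := functional_choice _ Hg.
exists (List.flat_map (fun b => List.map (f b).1 l1) l) => c [g [Hg0 <-]].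
have [Hk [kb ck]] := Hf (g e) (ex_intro _ g (conj Hg0 erefl)).
apply/in_flat_map; exists (g e); split; first by apply: Hl; exists g.
apply/in_map_iff; exists ((f (g e)).2 (g a)); split=> //; apply: Hl1.
exists (fun y => (f (g e)).2 (g y)); split=> //.
by split=> [|b ->//]; apply: HM.
Qed.

Lemma finite_orbit_stab H (E : list nat) a : perm_group H ->
  (forall e, In e E -> finite_orbit H e) ->
  finite_orbit (stab H (fun b => In b E)) a -> finite_orbit H a.
Proof.
elim: E H => [|e E IH] H gH HE fa.
  by apply: finite_orbit_sub fa => g Hg; split.
apply: (finite_orbit_stab1 H e) => //; first by apply: HE; left.
apply: IH.
- exact: perm_group_stab.
- move=> e' Ee'; apply: (finite_orbit_sub H) => [g []//|].
  by apply: HE; right.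
- apply: finite_orbit_sub fa => g [[Hg ge] gE]; split=> // b [<-|/gE//].
  exact: ge.
Qed.

Definition clos_closed (P : (nat -> nat) -> Prop) (F : list nat) : Prop :=
  forall a, clos P (fun b => In b F) a -> In a F.

Lemma clos_sub P (A : nat -> Prop) a : A a -> clos P A a.
Proof. by move=> Aa; exists (a :: nil)%list => b [g [[_ /(_ a Aa) ->] <-]]; left. Qed.

Lemma clos_mono P (A B : nat -> Prop) a : (forall b, A b -> B b) -> clos P A a -> clos P B a.
Proof. by move=> AB; apply: finite_orbit_sub => g [Pg gB]; split=> // b /AB/gB. Qed.

(** Closure is idempotent: the points of [F] have finite orbits under [stab P A], so by
    [finite_orbit_stab] fixing them too does not make an infinite orbit finite. *)
Lemma clos_list P A : closed_perm_group P -> locally_finite P -> finN A ->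
  exists F, (forall a, In a F <-> clos P A a) /\ clos_closed P F.
Proof.
move=> HP Hlf fA; have [l Hl] := Hlf A fA.
have [F HF] := list_filter _ (clos P A) l.
have HF' a : In a F <-> clos P A a by split=> [/HF[]//|cA]; apply/HF; split=> //; apply: Hl.
exists F; split=> // a ca; apply/HF'; have gP := closed_perm_group_group P HP.
apply: (finite_orbit_stab _ F); first exact: perm_group_stab.
- by move=> e /HF'.
- by apply: finite_orbit_sub ca => g [[Pg _] gF].
Qed.

(** Outside a closed [F] every orbit of its stabilizer is infinite, so [neumann] applies with all
    pairs from [A] minus [F] and [B] forbidden. *)
Lemma clos_closed_avoid P F (A B : list nat) : closed_perm_group P -> clos_closed P F ->
  exists k, stab P (fun a => In a F) k /\ forall a, In a A -> ~ In a F -> ~ In (k a) B.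
Proof.
move=> HP cF; have [A' HA'] := list_filter _ (fun a => ~ In a F) A.
have gP := closed_perm_group_group P HP.
have infA a : In a A' -> ~ finite_orbit (stab P (fun a => In a F)) a.
  by move=> /HA'[_ nF] /cF.
have [|k [Pk Hk]] := neumann _ A' (perm_group_stab P (fun a => In a F) gP) infA (list_prod A' B).
  by move=> [a b] /in_prod_iff[].
exists k; split=> // a Aa nF kB; apply: (Hk a (k a)) => //.
by apply/in_prod_iff; split=> //; apply/HA'.
Qed.

(** A point of the closure of the empty set would lie in both closures that freeness makes
    disjoint. *)
Lemma k_free_clos0 P k : (0 < k)%N -> k_free P k -> clos_closed P nil.
Proof.
move=> k0 /(_ (fun _ => False))[|gs [_ Hgs]]; first by exists nil.
by move=> a ca; case: (Hgs 0%nat k0 a); split; apply: clos_mono ca.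
Qed.

(** * Density of orbits with prescribed coordinates *)

Definition bsupp (c : bcode) : list nat := List.map (fun t => t.1.1) c.

Lemma box_ext c x y : (forall a, In a (bsupp c) -> x a = y a) -> box c x -> box c y.
Proof.
move=> xy cx i p q Hi; rewrite -xy; first exact: cx.
exact: (in_map (fun t => t.1.1) c (i, p, q)).
Qed.

Lemma mix_exists (D : list nat) (x y : RN) :
  exists w : RN, (forall a, In a D -> w a = x a) /\ (forall a, ~ In a D -> w a = y a).
Proof.
have H a : exists r, (In a D -> r = x a) /\ (~ In a D -> r = y a).
  by have [Da|nD] := classic (In a D); [exists (x a)|exists (y a)].
by have [w Hw] := functional_choice _ H; exists w; split=> a; have [] := Hw a.
Qed.

Section Shift.
Variables (P : (nat -> nat) -> Prop) (HP : closed_perm_group P).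

(** Some [k] moves the part of the support of [c] outside [F] off the finitely many coordinates that
    keep a point in [U]; these can then copy [x], and all others [y] transported by [k]. *)
Lemma box_transitive F U x c y : clos_closed P F -> openRN U -> U x -> box c y ->
  (forall a, In a F -> y a = x a) ->
  exists k x', stab P (fun a => In a F) k /\ U x' /\ box c (act x' k).
Proof.
move=> cF oU Ux cy yx; have [A [e [e0 HU]]] := oU x Ux.
have [k [[Pk kF] Hk]] := clos_closed_avoid P F (bsupp c) A HP cF.
have [Hperm _] := HP; have [k' [k'k _]] := Hperm k Pk.
have [x' [Hin Hout]] := mix_exists A x (act y k').
exists k, x'; split; first by []; split.
- apply: HU => i Ai; rewrite Hin //.
  by rewrite Rminus_diag Rabs_R0.
- apply: box_ext cy => b cb; rewrite /act.
  have [kA|nA] := classic (In (k b) A); last by rewrite Hout // /act k'k.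
  have Fb : In b F by apply: NNPP => nF; apply: (Hk b).
  by rewrite Hin // kF // yx.
Qed.

(* Boxes only look at finitely many coordinates, so countably many k suffice. *)
Lemma section_density H : comeager H -> comeager (fun x =>
  forall (F : seq nat) (c : bcode), clos_closed P F ->
    (exists y, box c y /\ forall a, In a F -> y a = x a) ->
    exists k, stab P (fun a => In a F) k /\ H (act x k) /\ box c (act x k)).
Proof.
move=> cH; apply: comeager_all => F; apply: comeager_all => c.
have [cF|ncF] := classic (clos_closed P F); last by apply: comeager_True.
(* One element of the stabilizer is chosen for each pair of finite lists of arguments and values,
   with the identity as default. *)
have Hk (BV : seq nat * seq nat) : exists k, stab P (fun a => In a F) k /\
    ((exists k', stab P (fun a => In a F) k' /\ List.map k' BV.1 = BV.2) ->
      List.map k BV.1 = BV.2).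
  have [[k ?]|nE] := classic
    (exists k', stab P (fun a => In a F) k' /\ List.map k' BV.1 = BV.2).
    by exists k; split; [|move=> _]; tauto.
  by exists (fun a => a); split=> [|/nE//]; split=> //; case: HP => _ [].
have [f Hf] := functional_choice _ Hk.
pose Q x := exists y, box c y /\ forall a, In a F -> y a = x a.
pose W x := exists BV, box c (act x (f BV)).
have oW : openRN W by apply: openRN_ex => BV; apply: openRN_act; apply: openRN_box.
have cQ : comeager (fun x => Q x -> W x).
  exists (fun _ x => Q x /\ ~ W x); split; last by move=> x nQW; exists 0%nat; tauto.
  move=> _ U oU exU.
  have [[x [Ux [y [cy yx]]]]|nE] := classic (exists x, U x /\ Q x); last first.
    by exists U; split=> //; split=> //; split=> // x Ux [Qx _]; apply: nE; exists x.
  have [k [x' [Pk [Ux' cx']]]] := box_transitive F U x c y cF oU Ux cy yx.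
  exists (fun x => U x /\ W x); split; first exact: openRN_and.
  split; last by split=> z [] // Uz Wz [].
  exists x'; split=> //; exists (bsupp c, List.map k (bsupp c)).
  apply: box_ext cx' => a ca; rewrite /act.
  have [_ E] := Hf (bsupp c, List.map k (bsupp c)).
  have {}E := E (ex_intro _ k (conj Pk erefl)).
  by rewrite (ext_in_map E).
have cHf : comeager (fun x => forall BV, H (act x (f BV))).
  apply: comeager_all => BV; have [[Pf _] _] := Hf BV.
  by apply: comeager_act => //; case: HP => /(_ _ Pf).
apply: comeager_sub (comeager_and _ _ cQ cHf) => x [QW Hx] _ /QW[BV cx].
by exists (f BV); have [] := Hf BV.
Qed.

(** Topological zero-one law: if [A] agrees generically with a nonempty open [U], a generic orbit
    enters [U] at a point of agreement, and invariance brings membership in [A] back to the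
    start. *)
Lemma comeager_of_invariant A : clos_closed P nil -> baire_property A ->
  (forall x k, P k -> A (act x k) -> A x) ->
  comeager A \/ comeager (fun x => ~ A x).
Proof.
move=> c0 [U [oU cU]] inv; have [[y Uy]|nE] := classic (exists y, U y); last first.
  by right; apply: comeager_sub cU => x AU /AU Ux; apply: nE; exists x.
left; have [c [cy HcU]] := box_nbhd U y oU Uy.
apply: comeager_sub (section_density _ cU) => x /(_ nil c c0)[].
  by exists y; split=> // a [].
by move=> k [[Pk _] [AU /HcU Ux]]; apply: (inv x k Pk); apply/AU.
Qed.

Lemma box_mix c (D : list nat) x y w : box c x -> box c y ->
  (forall a, In a D -> w a = x a) -> (forall a, ~ In a D -> w a = y a) -> box c w.
Proof.
move=> cx cy Hi Ho i p q ci; have [Di|nD] := classic (In i D).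
- by rewrite Hi //; apply: (cx i p q).
- by rewrite Ho //; apply: (cy i p q).
Qed.

(* A generic x can be moved by the stabilizer of D until it agrees with a given y on E, up to a
   small error, and then by the stabilizer of E until it is close to y; u survives both moves. *)
Lemma constant_of_disjoint_dependence (D E : list nat) c (u : RN -> R) (H : RN -> Prop) :
  clos_closed P D -> clos_closed P E -> (forall a, In a D -> In a E -> False) ->
  comeager H -> (exists x, box c x) ->
  (forall x k, stab P (fun a => In a D) k \/ stab P (fun a => In a E) k ->
    box c x -> H x -> box c (act x k) -> H (act x k) -> u (act x k) = u x) ->
  (forall x y, H x -> H y -> u y <> u x -> exists O, [/\ openRN O, O y &
    forall w, O w -> H w -> u w <> u x]) ->
  exists r, comeager (fun x => box c x -> u x = r).
Proof.
move=> cD cE DE cH exc dep sep.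
(* Density is added twice: the starting point must be movable over [D], and the point reached must
   again be movable over [E]. *)
have cH1 := comeager_and _ _ cH (section_density _ cH).
have cH2 := comeager_and _ _ cH1 (section_density _ cH1).
have [x0 [cx0 [[Hx0 _] SD0]]] := baire _ _ cH2 (openRN_box c) exc.
exists (u x0); apply: comeager_sub cH1 => y [Hy _] cy; apply: NNPP => neq.
have [O [oO Oy HO]] := sep x0 y Hx0 Hy neq.
have [c3 [c3y Hc3]] := box_nbhd _ _ (openRN_and _ _ oO (openRN_box c)) (conj Oy cy).
(* [c4] keeps the constraints of [c3] on coordinates in [E]. The first move can meet them because
   [E] misses [D]; the second fixes [E] and keeps them. *)
have [c4 Hc4] := list_filter _ (fun t => In t.1.1 E) c3.
have [w0 [w0D w0nD]] := mix_exists D x0 y.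
have cw0 := box_mix c D x0 y w0 cx0 cy w0D w0nD.
have [k [Pk [[Hk SDk] bk]]] : exists k, stab P (fun a => In a D) k /\
    (H (act x0 k) /\ forall (F : seq nat) (c : bcode), clos_closed P F ->
      (exists y, box c y /\ forall a, In a F -> y a = act x0 k a) ->
      exists k', stab P (fun a => In a F) k' /\ H (act (act x0 k) k') /\
        box c (act (act x0 k) k')) /\ box (c ++ c4)%list (act x0 k).
  apply: SD0 => //; exists w0; split=> // i p q /in_app_iff[/cw0//|/Hc4[/c3y iy /= Ei]].
  by rewrite w0nD // => Di; apply: (DE i).
have ck : box c (act x0 k) by move=> i p q ci; apply: bk; apply: in_or_app; left.
have [k' [Pk' [Hk' c3k']]] : exists k', stab P (fun a => In a E) k' /\
    H (act (act x0 k) k') /\ box c3 (act (act x0 k) k').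
  apply: SDk => //; have [w [wE wnE]] := mix_exists E (act x0 k) y.
  exists w; split=> // i p q ci; have [Ei|nE] := classic (In i E).
  - by rewrite wE //; apply: bk; apply: in_or_app; right; apply/Hc4.
  - by rewrite wnE //; apply: c3y.
have [Ok' ck'] := Hc3 _ c3k'.
apply: (HO _ Ok' Hk').
by rewrite (dep (act x0 k)) //; [apply: dep => //; left|right].
Qed.

End Shift.

(** * Local finite dependence *)

Section Dependence.
Variables (P : (nat -> nat) -> Prop) (HP : closed_perm_group P) (Hlf : locally_finite P).

(** For fixed [h] composition is a homeomorphism, and membership of [act x h] in a basic open set
    sees [h] at finitely many arguments only. *)
Lemma dense_interiorXP_open_dense D : openRN D -> denseRN D ->
  dense_interiorXP P (fun x h => D x /\ D (act x h)).
Proof.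
move=> oD dD; apply: dense_interiorXP_and => x h F e Ph e0.
- have [|x' [Bx' Dx']] := dD _ (openRN_ball x F e); first by exists x; apply: ballRN_center.
  have [F1 [e1 [e10 H1]]] := oD x' Dx'.
  by exists x', h, F1, e1; split=> // x'' h'' _ /H1.
- have [Hperm _] := HP; have [k [kh hk]] := Hperm h Ph.
  have [|y [By Dy]] := dD _ (openRN_act k _ (openRN_ball x F e)).
    exists (act x h); have -> : act (act x h) k = x; last exact: ballRN_center.
    by apply: functional_extensionality => a; rewrite /act hk.
  have [F1 [e1 [e10 H1]]] := oD y Dy.
  exists (act y k), h, (F1 ++ List.map h F1)%list, e1; split=> // x' h' _ B A.
  apply: H1 => i Fi; rewrite /act A; last by apply: in_or_app; left.
  have /B : In (h i) (F1 ++ List.map h F1) by apply: in_or_app; right; apply: in_map.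
  by rewrite /act kh.
Qed.

(** Takes the place of continuity of the coordinates of [z] on [G]: distinct values stay distinct
    nearby, also across different points and indices. *)
Definition separating (G : RN -> Prop) (z : RN -> RN) : Prop :=
  forall m m' y y', G y -> G y' -> z y m <> z y' m' ->
    exists c c', [/\ box c y, box c' y' &
      forall w w', box c w -> G w -> box c' w' -> G w' -> z w m <> z w' m'].

(** On [G] the sets cut out by comparing a coordinate with a rational coincide with open sets; a
    rational strictly between two values then yields the boxes. *)
Lemma comeager_separating (z : RN -> RN) :
  (forall m q, baire_property (fun x => z x m < q)) ->
  (forall m q, baire_property (fun x => q < z x m)) ->
  exists G, comeager G /\ separating G z.
Proof.
move=> Hlt Hgt.
have [L HL] := functional_choice _ (fun mq : nat * qcode => Hlt mq.1 (qval mq.2)).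
have [U HU] := functional_choice _ (fun mq : nat * qcode => Hgt mq.1 (qval mq.2)).
exists (fun x => (forall mq, z x mq.1 < qval mq.2 <-> L mq x) /\
                 (forall mq, qval mq.2 < z x mq.1 <-> U mq x)).
split.
  apply: comeager_and; apply: comeager_all => mq; first by have [] := HL mq.
  by have [] := HU mq.
have main m m' y y' :
    (forall mq, z y mq.1 < qval mq.2 <-> L mq y) ->
    (forall mq, qval mq.2 < z y' mq.1 <-> U mq y') -> z y m < z y' m' ->
    exists c c' q, [/\ box c y, box c' y', forall w, box c w -> L (m, q) w &
      forall w, box c' w -> U (m', q) w].
  move=> Gy Gy' /qval_between[q [yq qy]].
  have Ly : L (m, q) y by apply/Gy.
  have Uy' : U (m', q) y' by apply/Gy'.
  have [c [cy cL]] := box_nbhd _ _ (proj1 (HL (m, q))) Ly.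
  have [c' [cy' cU]] := box_nbhd _ _ (proj1 (HU (m', q))) Uy'.
  by exists c, c', q.
move=> m m' y y' [Ly Uy] [Ly' Uy'] /Rdichotomy[lt|gt].
- have [c [c' [q [cy cy' cL cU]]]] := main m m' y y' Ly Uy' lt.
  exists c, c'; split=> // w w' /cL /[swap] -[Lw _] /(Lw (m, q)) /= w1.
  by move=> /cU /[swap] -[_ Uw'] /(Uw' (m', q)) /= w2; lra.
- have [c [c' [q [cy cy' cL cU]]]] := main m' m y' y Ly' Uy gt.
  exists c', c; split=> // w w' /cU /[swap] -[_ Uw] /(Uw (m, q)) /= w1.
  by move=> /cL /[swap] -[Lw' _] /(Lw' (m', q)) /= w2; lra.
Qed.

Variables (z : RN -> RN).
Hypothesis z_orbit : forall x k m, P k -> exists m', z x m = z (act x k) m'.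

(** Otherwise, for every [m'], the pairs with [z x m <> z (act x h) m'] contain a dense open set
    relative to [U] and [G], and a generic pair contradicts [z_orbit]. *)
Lemma orbit_locally_matches G m U : comeager G -> separating G z ->
  openRN U -> (exists x, U x) ->
  exists m' c E h0, [/\ P h0, exists x, box c x, forall x, box c x -> U x &
    forall x h, P h -> box c x -> G x -> agree E h0 h -> G (act x h) ->
      z x m = z (act x h) m'].
Proof.
move=> cG sep oU [x0 Ux0]; apply: NNPP => nE.
have [D [oD [dD DG]]] := comeager_dense_opens G cG.
pose bad m' x h := U x -> G x -> G (act x h) -> z x m <> z (act x h) m'.
have dbad m' : dense_interiorXP P (bad m').
  move=> x h F e Ph e0.
  have [[x1 [Bx1 Ux1]]|nU] := classic (exists x1, ballRN x F e x1 /\ U x1); last first.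
    exists x, h, F, e; split=> //; first exact: ballRN_center.
    by move=> x' h' _ Bx' _ Ux'; case: nU; exists x'.
  have [c [cx1 Hc]] := box_nbhd _ x1 (openRN_and _ _ (openRN_ball x F e) oU) (conj Bx1 Ux1).
  have [x2 [h2 [Ph2 cx2 Gx2 A2 [Gxh2 neq]]]] : exists x2 h2,
      [/\ P h2, box c x2, G x2, agree F h h2 & G (act x2 h2) /\ z x2 m <> z (act x2 h2) m'].
    apply: NNPP => nE2; apply: nE; exists m', c, F, h; split=> //; first by exists x1.
      by move=> y /Hc[].
    move=> y k Pk cy Gy Ak Gyk; apply: NNPP => neq; apply: nE2.
    by exists y, k.
  have [c1 [c2 [c1x c2x H12]]] := sep m m' _ _ Gx2 Gxh2 neq.
  have [F1 [e1 [e10 H1]]] := openRN_box c1 _ c1x.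
  have [F2 [e2 [e20 H2]]] := openRN_box c2 _ c2x.
  exists x2, h2, (F1 ++ F2 ++ List.map h2 F2)%list, (Rmin e1 e2); split=> //.
  - by have [] := Hc _ cx2.
  - exact: Rmin_glb_lt.
  have m1 := Rmin_l e1 e2; have m2 := Rmin_r e1 e2.
  move=> x3 h3 Ph3 B3 A3 Ux3 Gx3 Gxh3; apply: H12 => //.
  - apply: H1 => i Fi; have := B3 i (in_or_app F1 _ i (or_introl Fi)); lra.
  - apply: H2 => i Fi.
    have iF : In i (F2 ++ List.map h2 F2) by apply: in_or_app; left.
    have hiF : In (h2 i) (F2 ++ List.map h2 F2) by apply: in_or_app; right; apply: in_map.
    rewrite /act A3; last exact: (in_or_app F1 _ i (or_intror iF)).
    have := B3 (h2 i) (in_or_app F1 _ _ (or_intror hiF)); lra.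
have [F [e [e0 HF]]] := oU x0 Ux0; have [_ [Pid _]] := HP.
have [|x [h [Ph [Bx [_ Hxh]]]]] := product_baire P HP
  (fun j x h => (D j x /\ D j (act x h)) /\ bad j x h) x0 (fun a => a) F e _ Pid e0.
  by move=> j; apply: dense_interiorXP_and; [apply: dense_interiorXP_open_dense|apply: dbad].
have [m' Hm'] := z_orbit x h m Ph.
have [_ Hbad] := Hxh m'; apply: Hbad Hm'; first exact: HF.
- by apply: DG => j; have [[]] := Hxh j.
- by apply: DG => j; have [[]] := Hxh j.
Qed.

(** [F] is the closure of the image of [E] under [h0]. If generic points agreeing on [F] had
    distinct values, one could be moved over [F] close to the other; but that move does not change
    its value. *)
Lemma local_dependence G m U : comeager G -> separating G z ->
  openRN U -> (exists x, U x) ->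
  exists c F G', [/\ clos_closed P F, exists x, box c x, forall x, box c x -> U x,
    comeager G' & forall x y, box c x -> G' x -> box c y -> G' y ->
      (forall a, In a F -> x a = y a) -> z x m = z y m].
Proof.
move=> cG sep oU exU.
have [m' [c [E [h0 [Ph0 exc cU match_z]]]]] := orbit_locally_matches G m U cG sep oU exU.
have [|F [HF cF]] := clos_list P (fun a => In a (List.map h0 E)) HP Hlf.
  by exists (List.map h0 E).
have [Hperm [_ [PM _]]] := HP.
have cG2 : comeager (fun y => G y /\ G (act y h0)).
  by apply: comeager_and => //; apply: comeager_act => //; apply: Hperm.
exists c, F; eexists; split=> //.
  exact: comeager_and cG (section_density P HP _ cG2).
move=> x y cx [Gx SDx] cy [Gy _] xy; apply: NNPP => neq.
have [c1 [c2 [c1x c2y H12]]] := sep m m x y Gx Gy neq.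
have [k [[Pk kF] [[Gxk Gxkh] bxk]]] : exists k, stab P (fun a => In a F) k /\
    (G (act x k) /\ G (act (act x k) h0)) /\ box (c ++ c2)%list (act x k).
  apply: SDx => //; exists y; split=> [i p q /in_app_iff[/cy|/c2y]|a /xy]//.
have cxk : box c (act x k) by move=> i p q ci; apply: bxk; apply: in_or_app; left.
have c2xk : box c2 (act x k) by move=> i p q ci; apply: bxk; apply: in_or_app; right.
apply: (H12 x (act x k)) => //.
(* Both [h0] and [k] after [h0] agree with [h0] on [E], so the two values are read at index [m'] of
   the same point. *)
rewrite (match_z (act x k) h0) //.
rewrite (match_z x (fun a => k (h0 a))) //; first exact: PM.
by move=> a Ea; rewrite kF //; apply/HF; apply: clos_sub; apply: in_map.
Qed.

End Dependence.

(** * Definable sets have the Baire property *)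

Section Codes.
Variables (L : language) (eR : Rsym L -> nat) (eF : Fsym L -> nat).
Hypotheses (eR_inj : forall r s, eR r = eR s -> r = s)
  (eF_inj : forall f g, eF f = eF g -> f = g).

Fixpoint term_code (t : term L) : GenTree.tree nat :=
  match t with
  | Var n => GenTree.Leaf n
  | App f args => GenTree.Node (eF f) [seq term_code (args i) | i <- enum 'I_(far f)]
  end.

Lemma map_enum_inj n (T : Type) (g h : 'I_n -> T) :
  [seq g i | i <- enum 'I_n] = [seq h i | i <- enum 'I_n] -> forall i, g i = h i.
Proof. by move=> /eq_in_map gh i; apply: gh; rewrite mem_enum. Qed.

Lemma term_code_inj t u : term_code t = term_code u -> t = u.
Proof.
elim: t u => [n|f args IH] [m|g args'] //= [].
- by move=> ->.
- move=> /eF_inj fg; case: g / fg args' => args' /map_enum_inj E.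
  by congr App; apply: functional_extensionality => i; apply: IH.
Qed.

(** Infinite conjunctions receive a dummy code, as only first-order formulas are to be
    enumerated. *)
Fixpoint formula_code (phi : formula L) : GenTree.tree nat :=
  match phi with
  | FEq t u => GenTree.Node 0 [:: term_code t; term_code u]
  | FRel r args => GenTree.Node 1 (GenTree.Leaf (eR r) ::
      [seq term_code (args i) | i <- enum 'I_(rar r)])
  | FNeg p => GenTree.Node 2 [:: formula_code p]
  | FAnd p q => GenTree.Node 3 [:: formula_code p; formula_code q]
  | FConj _ => GenTree.Leaf 0%N
  | FEx v p => GenTree.Node 4 [:: GenTree.Leaf v; formula_code p]
  end.

Lemma formula_code_inj phi psi : first_order phi -> first_order psi ->
  formula_code phi = formula_code psi -> phi = psi.
Proof.
elim: phi psi => [t u|r args|p IH|p IHp q IHq|ps IH|v p IH]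
  [t' u'|r' args'|p'|p' q'|ps'|v' p'] //=.
- by move=> _ _ [/term_code_inj-> /term_code_inj->].
- move=> _ _ [/eR_inj rr]; case: r' / rr args' => args' /map_enum_inj E.
  by congr FRel; apply: functional_extensionality => i; apply: term_code_inj.
- by move=> fp fp' [/(IH _ fp fp')->].
- by move=> [fp fq] [fp' fq'] [/(IHp _ fp fp')-> /(IHq _ fq fq')->].
- by move=> fp fp' [-> /(IH _ fp fp')->].
Qed.

End Codes.

Lemma first_order_enumeration (L : language) : countable_language L ->
  exists d : nat -> formula L, forall phi, first_order phi -> exists k, d k = phi.
Proof.
move=> [[eR eR_inj] [eF eF_inj]].
have H (k : nat) : exists psi : formula L,
    forall phi, first_order phi -> pickle (formula_code L eR eF phi) = k -> psi = phi.
  have [[phi [fo E]]|nE] := classic (exists phi : formula L,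
    first_order phi /\ pickle (formula_code L eR eF phi) = k).
    exists phi => psi fo' E'; apply: (formula_code_inj _ eR eF) => //.
    by apply: (pcan_inj pickleK); rewrite E E'.
  by exists (FEq (Var 0) (Var 0)) => phi fo E; case: nE; exists phi.
have [d Hd] := functional_choice _ H.
by exists d => phi fo; exists (pickle (formula_code L eR eF phi)); apply: Hd.
Qed.

Section Definability.
Variables (L : language) (N : RN -> structure L).
Hypotheses (N_rel : forall r bs, baire_property (fun x => srel (N x) r bs))
  (N_fun : forall f bs b, baire_property (fun x => sfun (N x) f bs = b)).

(** Splits into cases by the value of [g x]; finite functions are used because they form a countable
    type. *)
Lemma baire_property_tuple n (g : RN -> 'I_n -> nat) (Q : ('I_n -> nat) -> RN -> Prop) :
  (forall i a, baire_property (fun x => g x i = a)) ->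
  (forall bs, baire_property (Q bs)) -> baire_property (fun x => Q (g x) x).
Proof.
move=> Hg HQ.
apply: (baire_property_ext (fun x => exists bs : {ffun 'I_n -> nat},
  (forall i, g x i = bs i) /\ Q bs x)).
- move=> x; split=> [[bs [gbs Qbs]]|Qx].
    by have -> : g x = bs by apply: functional_extensionality => i; apply: gbs.
  have E : g x = [ffun i => g x i] :> ('I_n -> nat).
    by apply: functional_extensionality => i; rewrite ffunE.
  by exists [ffun i => g x i]; split=> [i|]; [rewrite ffunE|rewrite -E].
- apply: baire_property_ex => bs; apply: baire_property_and => //.
  by apply: baire_property_all => i.
Qed.

Lemma baire_property_eval s t a : baire_property (fun x => eval (N x) s t = a).
Proof.
elim: t a => [n|f args IH] a /=; first exact: baire_property_const.
by apply: (baire_property_tuple _ _ (fun bs x => sfun (N x) f bs = a)).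
Qed.

Lemma baire_property_sat s phi : baire_property (fun x => sat (N x) s phi).
Proof.
elim: phi s => [t u|r args|p IH|p IHp q IHq|ps IH|v p IH] s /=.
- apply: (baire_property_ext (fun x => exists a, eval (N x) s t = a /\ eval (N x) s u = a)).
    by move=> x; split=> [[a [-> ->]]|->]; last by exists (eval (N x) s u).
  by apply: baire_property_ex => a; apply: baire_property_and; apply: baire_property_eval.
- apply: (baire_property_tuple _ _ (fun bs x => srel (N x) r bs)) => // i a.
  exact: baire_property_eval.
- exact: baire_property_not.
- exact: baire_property_and.
- exact: baire_property_all.
- by apply: baire_property_ex => a; apply: IH.
Qed.

End Definability.

Lemma baire_measurable_coord (L : language) (f : RN -> RN * structure L) m q :
  baire_measurable f ->
  baire_property (fun x => (f x).1 m < q) /\ baire_property (fun x => q < (f x).1 m).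
Proof.
move=> mf; split.
- apply: (mf (fun y => y.1 m < q)) => y ym.
  exists (m :: nil), (q - y.1 m), nil, nil; split; first by lra.
  move=> y' /(_ m (or_introl erefl)); rewrite /Rabs; case: Rcase_abs => *; lra.
- apply: (mf (fun y => q < y.1 m)) => y ym.
  exists (m :: nil), (y.1 m - q), nil, nil; split; first by lra.
  move=> y' /(_ m (or_introl erefl)); rewrite /Rabs; case: Rcase_abs => *; lra.
Qed.

Lemma baire_measurable_srel (L : language) (f : RN -> RN * structure L) r bs :
  baire_measurable f -> baire_property (fun x => srel (f x).2 r bs).
Proof.
move=> mf; apply: (mf (fun y => srel y.2 r bs)) => y Hy.
exists nil, 1, (existT _ r bs :: nil), nil; split; first by lra.
by move=> y' _ [/(_ _ (or_introl erefl)) /= H _]; apply/H.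
Qed.

Lemma baire_measurable_sfun (L : language) (f : RN -> RN * structure L) s bs b :
  baire_measurable f -> baire_property (fun x => sfun (f x).2 s bs = b).
Proof.
move=> mf; apply: (mf (fun y => sfun y.2 s bs = b)) => y Hy.
exists nil, 1, nil, (existT _ s bs :: nil); split; first by lra.
by move=> y' _ [_ /(_ _ (or_introl erefl)) /= H]; rewrite H.
Qed.

(** * Isomorphisms and free variables *)

Definition iso_by (L : language) (g : nat -> nat) (N N' : structure L) : Prop :=
  [/\ is_perm g,
    forall r (bs : 'I_(rar r) -> nat), srel N' r (fun i => g (bs i)) <-> srel N r bs &
    forall f (bs : 'I_(far f) -> nat), sfun N' f (fun i => g (bs i)) = g (sfun N f bs)].

Lemma eval_iso (L : language) g (N N' : structure L) s t : iso_by L g N N' ->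
  eval N' (fun w => g (s w)) t = g (eval N s t).
Proof.
move=> [_ _ Hf]; elim: t => [//|f args IH] /=; rewrite -Hf.
by congr sfun; apply: functional_extensionality => i; apply: IH.
Qed.

Lemma upd_comp g s v a : (fun w => g (upd s v a w)) = upd (fun w => g (s w)) v (g a).
Proof. by apply: functional_extensionality => w; rewrite /upd; case: ifP. Qed.

Lemma sat_iso (L : language) g (N N' : structure L) s phi : iso_by L g N N' ->
  sat N' (fun w => g (s w)) phi <-> sat N s phi.
Proof.
move=> Hg; have [[h [hg gh]] Hr _] := Hg.
elim: phi s => [t u|r args|p IH|p IHp q IHq|ps IH|v p IH] s /=.
- rewrite !(eval_iso _ g N N') //; split=> [/(f_equal h)|->//].
  by rewrite !hg.
- rewrite -Hr; suff -> : (fun i => eval N' (fun w => g (s w)) (args i)) =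
    (fun i => g (eval N s (args i))) by [].
  by apply: functional_extensionality => i; apply: eval_iso.
- by rewrite IH.
- by rewrite IHp IHq.
- by split=> H k; apply/IH.
- split=> [[a]|[a /IH]].
    by rewrite -(gh a) -upd_comp => /IH; exists (h a).
  by rewrite upd_comp; exists (g a).
Qed.

Lemma eval_ext (L : language) (N : structure L) s s' t :
  (forall v, occurs v t -> s v = s' v) -> eval N s t = eval N s' t.
Proof.
elim: t => [n|f args IH] /= H; first exact: H.
by congr sfun; apply: functional_extensionality => i; apply: IH => v vi; apply: H; exists i.
Qed.

Lemma sat_ext (L : language) (N : structure L) s s' phi :
  (forall v, free v phi -> s v = s' v) -> sat N s phi <-> sat N s' phi.
Proof.
elim: phi s s' => [t u|r args|p IH|p IHp q IHq|ps IH|v p IH] s s' /= H.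
- by rewrite (eval_ext _ _ s s' t) ?(eval_ext _ _ s s' u) // => v ?; apply: H; [right|left].
- suff -> : (fun i => eval N s (args i)) = (fun i => eval N s' (args i)) by [].
  by apply: functional_extensionality => i; apply: eval_ext => v ?; apply: H; exists i.
- by rewrite (IH s s').
- by rewrite (IHp s s') ?(IHq s s') // => v ?; apply: H; [right|left].
- by split=> K k; [rewrite -(IH k s s')|rewrite (IH k s s')] => // v ?; apply: H; exists k.
- have E a w : free w p -> upd s v a w = upd s' v a w.
    rewrite /upd; case: (PeanoNat.Nat.eqb_spec w v) => // wv fw.
    by apply: H; split=> // vw; apply: wv.
  by split=> [[a Ha]|[a Ha]]; exists a; move: Ha; rewrite (IH _ (upd s' v a)) // => w /E.
Qed.

Lemma ord_bound n (Q : 'I_n -> nat -> Prop) :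
  (forall i, exists k, forall v, Q i v -> (v < k)%N) ->
  exists k, forall i v, Q i v -> (v < k)%N.
Proof.
move=> /functional_choice[K HK]; exists (\max_(i < n) K i)%N => i v /HK H.
exact: leq_trans H (leq_bigmax i).
Qed.

Lemma occurs_bound (L : language) (t : term L) : exists k, forall v, occurs v t -> (v < k)%N.
Proof.
elim: t => [n|f args /ord_bound[k Hk]] /=; first by exists n.+1 => v <-.
by exists k => v [i /Hk].
Qed.

(** Lets an assignment be cut down to a finite list, so that parameters range over a countable
    type. *)
Lemma first_order_free_bound (L : language) (phi : formula L) : first_order phi ->
  exists k, forall v, free v phi -> (v < k)%N.
Proof.
elim: phi => [t u|r args|p IH|p IHp q IHq|ps IH|v p IH] //=.
- move=> _; have [k Hk] := occurs_bound _ t; have [k' Hk'] := occurs_bound _ u.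
  by exists (maxn k k') => v [/Hk|/Hk'] H; rewrite leq_max H ?orbT.
- move=> _; have [i|k Hk] := ord_bound _ (fun i v => occurs v (args i)).
    exact: occurs_bound.
  by exists k => v [i /Hk].
- move=> [/IHp[k Hk] /IHq[k' Hk']].
  by exists (maxn k k') => v [/Hk|/Hk'] H; rewrite leq_max H ?orbT.
- by move=> /IH[k Hk]; exists k => w [_ /Hk].
Qed.

(** Serves to pass from algebraic to definable: of finitely many solutions [l], injectivity of the
    labels [z] leaves only one inside the interval. *)
Lemma isolating_interval (z : RN) (l : list nat) r : exists p q, qval p < r < qval q /\
  forall a, In a l -> qval p < z a < qval q -> z a = r.
Proof.
elim: l => [|a l [p [q [rpq Hl]]]].
  have [p Hp] := qval_between (r - 1) r ltac:(lra).
  have [q Hq] := qval_between r (r + 1) ltac:(lra).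
  by exists p, q; split=> //; lra.
have [E|ne] := classic (z a = r).
  by exists p, q; split=> // b [<-//|/Hl].
have [lt|gt] := Rdichotomy _ _ ne.
- have m1 := Rmax_l (z a) (qval p); have m2 := Rmax_r (z a) (qval p).
  have [|p' Hp'] := qval_between (Rmax (z a) (qval p)) r; first by apply: Rmax_lub_lt; lra.
  by exists p', q; split=> [|b [<-|/Hl H]] *; [lra|lra|apply: H; lra].
- have m1 := Rmin_l (z a) (qval q); have m2 := Rmin_r (z a) (qval q).
  have [|q' Hq'] := qval_between r (Rmin (z a) (qval q)); first by apply: Rmin_glb_lt; lra.
  by exists p, q'; split=> [|b [<-|/Hl H]] *; [lra|lra|apply: H; lra].
Qed.

Lemma baire_property_eq (u w : RN -> R) :
  (forall q, baire_property (fun x => u x < q)) ->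
  (forall q, baire_property (fun x => q < u x)) ->
  (forall q, baire_property (fun x => w x < q)) ->
  (forall q, baire_property (fun x => q < w x)) ->
  baire_property (fun x => u x = w x).
Proof.
move=> u1 u2 w1 w2; apply: (baire_property_ext (fun x => forall q : qcode,
  ~ (u x < qval q /\ qval q < w x) /\ ~ (w x < qval q /\ qval q < u x))).
- move=> x; split=> [H|-> q]; last by split; lra.
  by apply: NNPP => /Rdichotomy[|] /qval_between[q Hq]; have [] := H q.
- apply: baire_property_all => q.
  by apply: baire_property_and; apply: baire_property_not; apply: baire_property_and.
Qed.

(** * Generic constancy of the values *)

Section Invariant.
Variables (P : (nat -> nat) -> Prop) (HP : closed_perm_group P) (Hlf : locally_finite P).
Variables (L : language) (HL : countable_language L) (sigma : formula L).
Variables (f : RN -> RN * structure L) (f_mod : forall x, in_StrInj sigma (f x))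
  (f_meas : baire_measurable f) (f_inv : forall x x', EP P x x' -> iso_rel (f x) (f x')).

Let z x : RN := (f x).1.
Let N x : structure L := (f x).2.

Lemma iso_act x k : P k ->
  exists g, iso_by L g (N x) (N (act x k)) /\ forall b, z (act x k) (g b) = z x b.
Proof.
move=> Pk; have [_ [_ [_ [PV _]]]] := HP; have [k' [Pk' [_ kk']]] := PV k Pk.
have [|g [pg [gz [gr gf]]]] := f_inv x (act x k).
  by exists k'; split=> // b; rewrite /act kk'.
by exists g; split=> //; split.
Qed.

Lemma z_orbit_in x k m : P k -> exists m', z x m = z (act x k) m'.
Proof. by move=> /(iso_act x)[g [_ gz]]; exists (g m). Qed.

Lemma z_orbit_out x k m : P k -> exists m', z x m' = z (act x k) m.
Proof.
by move=> /(iso_act x)[g [[[h [_ gh]] _ _] gz]]; exists (h m); rewrite -gz gh.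
Qed.

Lemma z_inj x a b : z x a = z x b -> a = b.
Proof. by have [inj _] := f_mod x; apply: inj. Qed.

Lemma baire_property_z_lt m q : baire_property (fun x => z x m < q).
Proof. exact: (proj1 (baire_measurable_coord L f m q f_meas)). Qed.

Lemma baire_property_z_gt m q : baire_property (fun x => q < z x m).
Proof. exact: (proj2 (baire_measurable_coord L f m q f_meas)). Qed.

Lemma baire_property_z_eq_act a m g : is_perm g ->
  baire_property (fun x => z x a = z (act x g) m).
Proof.
move=> pg; apply: baire_property_eq => q.
- exact: baire_property_z_lt.
- exact: baire_property_z_gt.
- exact: baire_property_act (baire_property_z_lt m q).
- exact: baire_property_act (baire_property_z_gt m q).
Qed.

Lemma baire_property_N_sat s phi : baire_property (fun x => sat (N x) s phi).
Proof.
apply: baire_property_sat => *; first exact: baire_measurable_srel.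
exact: baire_measurable_sfun.
Qed.

Section Constant.
Variables (n : nat) (Hfree : k_free P n.+1).
Hypothesis Hacl : forall (M : structure L), models M sigma ->
  forall b : 'I_n.+1 -> nat,
    exists i : 'I_n.+1, acl M (fun a => exists j : 'I_n.+1, j <> i /\ a = b j) (b i).

(** A countable type, so that by category a single witness serves on an open set. The list
    interprets the variables, with [0] beyond its end. *)
Definition witness := ('I_n.+1 * {ffun 'I_n.+1 -> nat} * nat * nat * seq nat * qcode * qcode)%type.

(* The i-th of the numbers r j is the only element of the range of z x in a rational interval
   with a given first-order property over the others; b lists their indices in z x. *)
Definition isolates (d : nat -> formula L) (r : 'I_n.+1 -> RN -> R) (t : witness) (x : RN) : Prop :=
  let: (i, b, k, v, l, p, q) := t in
  [/\ forall w, free w (d k) -> w <> v -> exists j, j <> i /\ nth 0%N l w = b j,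
    forall j, z x (b j) = r j x,
    sat (N x) (upd (nth 0%N l) v (b i)) (d k),
    qval p < z x (b i) < qval q &
    forall a, qval p < z x a < qval q -> sat (N x) (upd (nth 0%N l) v a) (d k) -> a = b i].

Lemma baire_property_isolates d m (gs : 'I_n.+1 -> nat -> nat) t :
  (forall j, is_perm (gs j)) ->
  baire_property (isolates d (fun j x => z (act x (gs j)) m) t).
Proof.
move=> pg; case: t => [[[[[[i b] k] v] l] p] q].
have bI a : baire_property (fun x => qval p < z x a < qval q).
  by apply: baire_property_and; [apply: baire_property_z_gt|apply: baire_property_z_lt].
apply: (baire_property_ext (fun x =>
  (forall w, free w (d k) -> w <> v -> exists j, j <> i /\ nth 0%N l w = b j) /\
  (forall j, z x (b j) = z (act x (gs j)) m) /\
  sat (N x) (upd (nth 0%N l) v (b i)) (d k) /\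
  (qval p < z x (b i) < qval q) /\
  forall a, ~ (~ (a = b i) /\ (qval p < z x a < qval q) /\
    sat (N x) (upd (nth 0%N l) v a) (d k)))).
- move=> x; split=> [[? [? [? [? H]]]]|[? ? ? ? H]].
    by split=> // a pq Ha; apply: NNPP => ne; apply: (H a).
  by do !split=> //; move=> a [ne [pq Ha]]; apply: ne; apply: H.
- apply: baire_property_and; first exact: baire_property_const.
  apply: baire_property_and.
    by apply: baire_property_all => j; apply: baire_property_z_eq_act.
  apply: baire_property_and; first exact: baire_property_N_sat.
  apply: baire_property_and => //.
  apply: baire_property_all => a; apply: baire_property_not.
  apply: baire_property_and; first exact: baire_property_const.
  by apply: baire_property_and => //; apply: baire_property_N_sat.
Qed.

Lemma exists_isolates d r x : (forall phi, first_order phi -> exists k, d k = phi) ->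
  (forall j, exists a, z x a = r j x) -> exists t, isolates d r t x.
Proof.
move=> Hd /functional_choice[b Hb]; have [_ modN] := f_mod x.
have [i [phi [v [s [fo [Hs [Hsat [l0 Hl0]]]]]]]] := Hacl _ modN b.
have [k dk] := Hd phi fo; have [K HK] := first_order_free_bound _ phi fo.
have [p [q [rpq Hpq]]] := isolating_interval (z x) l0 (z x (b i)).
have E w : free w phi -> nth 0%N (mkseq s K) w = s w by move=> /HK; apply: nth_mkseq.
have Eupd a : sat (N x) (upd (nth 0%N (mkseq s K)) v a) phi <-> sat (N x) (upd s v a) phi.
  by apply: sat_ext => w /E; rewrite /upd => ->.
exists (i, finfun b, k, v, mkseq s K, p, q); rewrite /isolates dk !ffunE.
split=> //.
- move=> w fw wv; have [j [ji sj]] := Hs w fw wv.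
  by exists j; split=> //; rewrite E // ffunE.
- by move=> j; rewrite ffunE.
- exact/Eupd.
- by move=> a apq /Eupd Ha; apply: (z_inj x); apply: Hpq => //; apply: Hl0.
Qed.

(** The isomorphism [g] coming from [h] preserves labels, so it fixes each [b j] with [j <> i]; it
    sends [b i] to a solution of the same formula in the same interval, which uniqueness at
    [act x h] identifies with [b i]. *)
Lemma isolates_transfer d r i b k v l p q x h :
  isolates d r (i, b, k, v, l, p, q) x ->
  isolates d r (i, b, k, v, l, p, q) (act x h) -> P h ->
  (forall j, j <> i -> r j x = r j (act x h)) -> r i x = r i (act x h).
Proof.
move=> [side rx satx ix _] [_ rxh _ _ ux] Ph Hr.
have [g [Hg gz]] := iso_act x h Ph.
have gb j : j <> i -> g (b j) = b j.
  by move=> ji; apply: (z_inj (act x h)); rewrite gz rx rxh Hr.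
rewrite -rx -rxh -gz; congr z; apply: ux; first by rewrite gz.
move: satx => /(sat_iso _ g (N x) (N (act x h)) _ _ Hg).
rewrite upd_comp; apply: (proj1 (sat_ext _ _ _ _ _ _)) => w fw.
rewrite /upd; case: (PeanoNat.Nat.eqb_spec w v) => // wv.
by have [j [ji ->]] := side w fw wv; apply: gb.
Qed.

(** The copies of [A] under the [gs i] are disjoint, since their closures are, so one point can
    carry a copy of [x0] on each of them. *)
Lemma joint_box c (A : list nat) (gs : nat -> nat -> nat) :
  (exists x, box c x) -> incl (bsupp c) A -> (forall i, (i < n.+1)%N -> is_perm (gs i)) ->
  (forall i, (i < n.+1)%N -> forall a,
    ~ (clos P (img (gs i) (fun a => In a A)) a /\
       clos P (fun b => exists j, (j < n.+1)%N /\ j <> i /\ img (gs j) (fun a => In a A) b) a)) ->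
  exists w, forall i : 'I_n.+1, box c (act w (gs i)).
Proof.
move=> [x0 cx0] cA pgs dis.
have H a : exists r, forall i b, (i < n.+1)%N -> In b A -> a = gs i b -> r = x0 b.
  have [[i [b [ii Ab ab]]]|nE] := classic (exists i b, [/\ (i < n.+1)%N, In b A & a = gs i b]);
    last by exists 0 => i b ii Ab ab; case: nE; exists i, b.
  exists (x0 b) => j b' jj Ab' ab'; congr x0.
  have [ij|ij] := classic (j = i); last first.
    case: (dis i ii a); split; apply: clos_sub; first by exists b.
    by exists j; split=> //; split=> //; exists b'.
  have [h [hg _]] := pgs i ii.
  by rewrite -(hg b) -(hg b') -ab -{1}ij -ab'.
have [w Hw] := functional_choice _ H.
exists w => i; apply: box_ext cx0 => a /cA Aa.
by rewrite /act (Hw _ i a).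
Qed.

Lemma constant_value m U : openRN U -> (exists x, U x) ->
  exists c r, [/\ exists x, box c x, forall x, box c x -> U x &
    comeager (fun x => box c x -> z x m = r)].
Proof.
move=> oU exU; have [Hperm [Pid [PM PV]]] := HP.
have [G [cG sepG]] := comeager_separating z baire_property_z_lt baire_property_z_gt.
have [c [E [G' [cE exc cU cG' dep]]]] :=
  local_dependence P HP Hlf z z_orbit_in G m U cG sepG oU exU.
(* [bsupp c] makes the copies of the box [c] jointly satisfiable; [E] carries the dependence of the
   value. *)
pose A := (bsupp c ++ E)%list.
have [|gs [Pgs dis]] := Hfree (fun a => In a A); first by exists A.
have pgs i : (i < n.+1)%N -> is_perm (gs i) by move=> /Pgs/Hperm.
have cA : incl (bsupp c) A by move=> a ca; apply: in_or_app; left.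
have [w0 Hw0] := joint_box c A gs exc cA pgs dis.
have [d Hd] := first_order_enumeration L HL.
pose r (j : 'I_n.+1) x := z (act x (gs j)) m.
have bp t := baire_property_isolates d m (fun j : 'I_n.+1 => gs j) t (fun j => pgs j (ltn_ord j)).
have [V HV] := functional_choice _ bp.
pose W x := forall j : 'I_n.+1, box c (act x (gs j)).
have oW : openRN W by apply: openRN_forall => j; apply: openRN_act; apply: openRN_box.
have cV : comeager (fun x => forall t, isolates d r t x <-> V t x).
  by apply: comeager_all => t; have [] := HV t.
have [x1 [Wx1 HVx1]] := baire _ _ cV oW (ex_intro _ w0 Hw0).
have [j|t] := exists_isolates d r x1 Hd; first exact: z_orbit_out (Pgs _ (ltn_ord j)).
move=> /[dup] iso1 /HVx1 Vx1.
(* On [c'] the witness found at [x1] stays valid at generic points, since [isolates d r t] agrees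
   generically with the open set [V t]. *)
have [c' [c'x1 Hc']] := box_nbhd _ x1 (openRN_and _ _ oW (proj1 (HV t))) (conj Wx1 Vx1).
case: t iso1 Vx1 Hc' => [[[[[[i b] k] v] l] p] q] iso1 Vx1 Hc'.
have fA i' : finN (img (gs i') (fun a => In a A)).
  by exists (List.map (gs i') A) => a [a' [Aa' ->]]; apply: in_map.
(* [D] closes the copies other than the [i]-th and [E'] closes the [i]-th. Elements fixing [D]
   preserve [r i] by definability, elements fixing [E'] by local dependence. *)
have [|D [HD cD]] := clos_list P
  (fun a => exists j, (j < n.+1)%N /\ j <> i /\ img (gs j) (fun a => In a A) a) HP Hlf.
  exists (List.flat_map (fun j => List.map (gs j) A) (List.seq 0 n.+1)) => a [j [jn [_ [a' [Aa' ->]]]]].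
  apply/in_flat_map; exists j; split; last exact: in_map.
  by apply/List.in_seq; move/ltP: jn; lia.
have [E' [HE' cE']] := clos_list P _ HP Hlf (fA i).
pose H x := (forall t, isolates d r t x <-> V t x) /\
  ((forall j : 'I_n.+1, G' (act x (gs j))) /\ G (act x (gs i))).
have cH : comeager H.
  apply: comeager_and => //; apply: comeager_and.
    by apply: comeager_all => j; apply: comeager_act => //; apply: pgs.
  by apply: comeager_act => //; apply: pgs.
have depE x h (j : 'I_n.+1) : P h -> (forall a, In a E -> h (gs j a) = gs j a) ->
    box c' x -> H x -> box c' (act x h) -> H (act x h) -> r j x = r j (act x h).
  move=> Ph hE /Hc'[Wx _] [_ [G'x _]] /Hc'[Wxh _] [_ [G'xh _]].
  by apply: dep => // a Ea; rewrite /act hE.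
have AE a : In a E -> In a A by move=> Ea; apply: in_or_app; right.
have [||||s cs] := constant_of_disjoint_dependence P HP D E' c' (r i) H cD cE' _ cH.
- by move=> a /HD Da /HE' Ea; apply: (dis i (ltn_ord i) a).
- by exists x1.
- move=> x h [] [Ph hF] cx Hx cxh Hxh; symmetry; last first.
    apply: depE => // a Ea; apply: hF; apply/HE'; apply: clos_sub.
    by exists a; split=> //; apply: AE.
  have [_ Vx] := Hc' _ cx; have [_ Vxh] := Hc' _ cxh.
  have [isox _] := Hx; have [isoxh _] := Hxh.
  apply: (isolates_transfer d r i b k v l p q) => //; first exact/isox.
    exact/isoxh.
  move=> j ji; apply: depE => // a Ea; apply: hF; apply/HD; apply: clos_sub.
  exists j; split=> //; split; first by move=> /ord_inj.
  by exists a; split=> //; apply: AE.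
- move=> x y [_ [_ Gx]] [_ [_ Gy]] neq.
  have [c1 [c2 [c1y c2x sep]]] := sepG m m _ _ Gy Gx neq.
  exists (fun w => box c1 (act w (gs i))); split=> //.
    by apply: openRN_act; apply: openRN_box.
  by move=> w c1w [_ [_ Gw]]; apply: sep.
(* [r i] is [z _ m] after the shift by [gs i]; undoing the shift carries the box and the constancy
   over to [z _ m] itself. *)
have [h [hg gh]] := pgs i (ltn_ord i).
have actK x : act (act x h) (gs i) = x.
  by apply: functional_extensionality => a; rewrite /act hg.
have actK' x : act (act x (gs i)) h = x.
  by apply: functional_extensionality => a; rewrite /act gh.
have [|c4 [c4x Hc4]] := box_nbhd _ (act x1 (gs i)) (openRN_act h _ (openRN_box c')).
  by rewrite actK'.
exists c4, s; split; first by exists (act x1 (gs i)).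
- by move=> x /Hc4/Hc'[/(_ i)]; rewrite actK => /cU.
- have ph : is_perm h by exists (gs i).
  apply: comeager_sub (comeager_act h _ ph cs) => x Hx /Hc4/Hx.
  by rewrite /r actK.
Qed.

(** * Generic constancy of the structure *)

(** The boxes on which [z _ m] is generically constant have dense union by [constant_value], and
    there are countably many. On other boxes [lam] takes an arbitrary value. *)
Lemma values_countable : exists lam : nat * bcode -> R,
  comeager (fun x => forall m, exists t, z x m = lam t).
Proof.
have Hlam (t : nat * bcode) : exists r,
    (exists r', comeager (fun x => box t.2 x -> z x t.1 = r')) ->
    comeager (fun x => box t.2 x -> z x t.1 = r).
  have [[r Hr]|nE] := classic (exists r', comeager (fun x => box t.2 x -> z x t.1 = r')).
    by exists r.
  by exists 0 => /nE.
have [lam Hl] := functional_choice _ Hlam; exists lam.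
pose good t := comeager (fun x => box t.2 x -> z x t.1 = lam t).
have cgood : comeager (fun x => forall t, good t -> box t.2 x -> z x t.1 = lam t).
  apply: comeager_all => t; have [gt|ngt] := classic (good t).
    by apply: comeager_sub gt => x Hx _.
  by apply: comeager_True => x /ngt.
have cbox m : comeager (fun x => exists c, good (m, c) /\ box c x).
  apply: comeager_open_dense.
    apply: openRN_ex => c; apply: openRN_and; first exact: openRN_const.
    exact: openRN_box.
  move=> U oU exU; have [c [r [[x cx] cU cr]]] := constant_value m U oU exU.
  exists x; split; first exact: cU.
  by exists c; split=> //; apply: (Hl (m, c)); exists r.
apply: comeager_sub (comeager_and _ _ cgood (comeager_all _ _ cbox)) => x [Hgood Hbox] m.
by have [c [gc cx]] := Hbox m; exists (m, c); apply: (Hgood (m, c)).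
Qed.

Lemma clos_closed_nil : clos_closed P nil.
Proof. exact: (k_free_clos0 P n.+1). Qed.

Lemma invariant_generically_constant A : baire_property A ->
  (forall x k, P k -> A (act x k) -> A x) -> generically (fun x y => A x <-> A y).
Proof.
move=> bA iA; have [cA|cA] := comeager_of_invariant P HP A clos_closed_nil bA iA.
- by exists A; split=> // x y Ax Ay.
- by exists (fun x => ~ A x); split=> // x y nAx nAy; split=> [/nAx|/nAy].
Qed.

Lemma iso_act_inv x k : P k ->
  exists g, iso_by L g (N (act x k)) (N x) /\ forall b, z x (g b) = z (act x k) b.
Proof.
move=> Pk; have [|g [pg [gz [gr gf]]]] := f_inv (act x k) x; first by exists k.
by exists g; split=> //; split.
Qed.

(** * Isomorphism invariants expressed through countably many labels *)

Section Invariants.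
Variable lam : nat * bcode -> R.

(** Elements are named by their labels [lam t] and not by indices: isomorphisms preserve labels, so
    such facts are invariant along orbits. *)
Definition rel_fact (r : Rsym L) (ts : {ffun 'I_(rar r) -> nat * bcode}) (x : RN) : Prop :=
  exists bs : {ffun 'I_(rar r) -> nat}, (forall i, z x (bs i) = lam (ts i)) /\ srel (N x) r bs.

Definition fun_fact (s : Fsym L) (ts : {ffun 'I_(far s) -> nat * bcode}) t (x : RN) : Prop :=
  exists bs : {ffun 'I_(far s) -> nat}, (forall i, z x (bs i) = lam (ts i)) /\
    z x (sfun (N x) s bs) = lam t.

Lemma indices_unique k (ts : 'I_k -> nat * bcode) (bs bs' : 'I_k -> nat) x :
  (forall i, z x (bs i) = lam (ts i)) -> (forall i, z x (bs' i) = lam (ts i)) -> bs = bs'.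
Proof.
by move=> H H'; apply: functional_extensionality => i; apply: (z_inj x); rewrite H H'.
Qed.

Lemma finfun_eta (T : Type) k (g : 'I_k -> T) : (finfun g : 'I_k -> T) = g.
Proof. by apply: functional_extensionality => i; rewrite ffunE. Qed.

Lemma rel_factE r (ts : {ffun 'I_(rar r) -> nat * bcode}) bs x :
  (forall i, z x (bs i) = lam (ts i)) -> rel_fact r ts x <-> srel (N x) r bs.
Proof.
move=> H; split=> [[bs' [H' Hr]]|Hr].
- by rewrite (indices_unique _ ts bs bs' x).
- by exists (finfun bs); rewrite finfun_eta.
Qed.

Lemma fun_factE s (ts : {ffun 'I_(far s) -> nat * bcode}) t bs x :
  (forall i, z x (bs i) = lam (ts i)) -> fun_fact s ts t x <-> z x (sfun (N x) s bs) = lam t.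
Proof.
move=> H; split=> [[bs' [H' Hr]]|Hr].
- by rewrite (indices_unique _ ts bs bs' x).
- by exists (finfun bs); rewrite finfun_eta.
Qed.

Lemma baire_property_z_eq m r : baire_property (fun x => z x m = r).
Proof.
apply: baire_property_eq => q; try exact: baire_property_const.
- exact: baire_property_z_lt.
- exact: baire_property_z_gt.
Qed.

Lemma in_range_constant t : 
  generically (fun x y => (exists m, z x m = lam t) <-> exists m, z y m = lam t).
Proof.
apply: invariant_generically_constant.
- by apply: baire_property_ex => m; apply: baire_property_z_eq.
- by move=> x k Pk [m Hm]; have [m' Hm'] := z_orbit_out x k m Pk; exists m'; rewrite Hm'.
Qed.

Lemma rel_fact_constant r ts : generically (fun x y => rel_fact r ts x <-> rel_fact r ts y).
Proof.
apply: invariant_generically_constant.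
- apply: baire_property_ex => bs; apply: baire_property_and.
    by apply: baire_property_all => i; apply: baire_property_z_eq.
  exact: baire_measurable_srel.
- move=> x k Pk [bs [H Hr]]; have [g [[_ gr _] gz]] := iso_act_inv x k Pk.
  apply/(rel_factE r ts (fun i => g (bs i))); last exact/gr.
  by move=> i; rewrite gz.
Qed.

Lemma fun_fact_constant s ts t : 
  generically (fun x y => fun_fact s ts t x <-> fun_fact s ts t y).
Proof.
apply: invariant_generically_constant.
- apply: baire_property_ex => bs; apply: baire_property_and.
    by apply: baire_property_all => i; apply: baire_property_z_eq.
  apply: (baire_property_ext (fun x => exists b, sfun (N x) s bs = b /\ z x b = lam t)).
    by move=> x; split=> [[b [-> //]]|H]; exists (sfun (N x) s bs).
  apply: baire_property_ex => b; apply: baire_property_and; last exact: baire_property_z_eq.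
  exact: baire_measurable_sfun.
- move=> x k Pk [bs [H Hr]]; have [g [[_ _ gf] gz]] := iso_act_inv x k Pk.
  apply/(fun_factE s ts t (fun i => g (bs i))); last by rewrite gf gz.
  by move=> i; rewrite gz.
Qed.

Definition same_facts x y : Prop :=
  (forall t, (exists m, z x m = lam t) <-> (exists m, z y m = lam t)) /\
  (forall r ts, rel_fact r ts x <-> rel_fact r ts y) /\
  (forall s ts t, fun_fact s ts t x <-> fun_fact s ts t y).

Lemma generically_same_facts : generically same_facts.
Proof.
have [[eR eR_inj] [eF eF_inj]] := HL.
have pI (T : countType) : injective (@pickle T) := pcan_inj pickleK.
apply: generically_and; last apply: generically_and.
- by apply: (generically_all _ pickle _ (pI _)) => t; apply: in_range_constant.
- apply: (generically_all _ eR) => // r; apply: (generically_all _ pickle _ (pI _)) => ts.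
  exact: rel_fact_constant.
- apply: (generically_all _ eF) => // s; apply: (generically_all _ pickle _ (pI _)) => ts.
  by apply: (generically_all _ pickle _ (pI _)) => t; apply: fun_fact_constant.
Qed.

(** Equal ranges and injective labels give a bijection [g] matching equal labels; since every label
    is some [lam t], the shared facts determine all relations and functions. *)
Lemma iso_of_same_facts x y : (forall m, exists t, z x m = lam t) ->
  (forall m, exists t, z y m = lam t) -> same_facts x y -> iso_rel (f x) (f y).
Proof.
move=> Lx Ly [same_range [same_rel same_fun]].
have [tx Htx] := functional_choice _ Lx.
have Hg m : exists m', z y m' = z x m.
  have [m' E] := proj1 (same_range (tx m)) (ex_intro _ m (Htx m)).
  by exists m'; rewrite E Htx.
have Hh m : exists m', z x m' = z y m.
  have [t Ht] := Ly m; have [m' E] := proj2 (same_range t) (ex_intro _ m Ht).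
  by exists m'; rewrite E Ht.
have [g gz] := functional_choice _ Hg; have [h hz] := functional_choice _ Hh.
exists g; split.
  exists h; split=> a; first by apply: (z_inj x); rewrite hz gz.
  by apply: (z_inj y); rewrite gz hz.
split; first exact: gz.
split=> [r bs|s bs].
- pose ts := [ffun i => tx (bs i)].
  have Ex i : z x (bs i) = lam (ts i) by rewrite ffunE Htx.
  have Ey i : z y (g (bs i)) = lam (ts i) by rewrite gz.
  rewrite -[X in X <-> _](rel_factE r ts (fun i => g (bs i)) y Ey) -same_rel.
  exact: rel_factE.
- pose ts := [ffun i => tx (bs i)].
  have Ex i : z x (bs i) = lam (ts i) by rewrite ffunE Htx.
  have Ey i : z y (g (bs i)) = lam (ts i) by rewrite gz.
  apply: (z_inj y); rewrite gz Htx.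
  apply/(fun_factE s ts _ (fun i => g (bs i)) y Ey)/same_fun.
  by apply/(fun_factE s ts _ bs x Ex); rewrite Htx.
Qed.

End Invariants.

Lemma generically_isomorphic : exists C, comeager C /\ exists y0, forall x, C x -> iso_rel (f x) y0.
Proof.
have [lam cval] := values_countable.
have [C [cC HC]] := generically_same_facts lam.
have cD := comeager_and _ _ cC cval.
have [x0 [_ [Cx0 vx0]]] := baire _ _ cD (openRN_const True) (ex_intro _ (fun _ => 0) I).
eexists; split; first exact: cD.
by exists (f x0) => x [Cx vx]; apply: iso_of_same_facts vx vx0 _; apply: HC.
Qed.

End Constant.
End Invariant.

Theorem theorem3p8 (n : nat) (P : (nat -> nat) -> Prop)
  (HP : closed_perm_group P) (Hlf : locally_finite P) (Hfree : k_free P n.+1)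
  (L : language) (HL : countable_language L) (sigma : formula L)
  (Hsig : is_sentence sigma)
  (Hacl : forall (N : structure L), models N sigma ->
     forall b : 'I_n.+1 -> nat,
       exists i : 'I_n.+1, acl N (fun a => exists j : 'I_n.+1, j <> i /\ a = b j) (b i)) :
  generically_iso_ergodic P sigma.
Proof.
move=> f f_mod f_meas f_inv.
exact: (generically_isomorphic P HP Hlf L HL sigma f f_mod f_meas f_inv n Hfree Hacl).
Qed.
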